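(* Let $\overline{X}=(X_0,X_1)$ be a compatible (quasi-)Banach couple and let $0<\theta_0<\theta_1<1$. Let $E_0,E_1,F_0,F_1$ be r.i. spaces and let $a_0,a_1,b_0,b_1\in SV$ be such that $\|b_0\|_{\widetilde{E}_0(1,\infty)}<\infty$ and $\|b_1\|_{\widetilde{E}_1(1,\infty)}<\infty$. Put $$\rho(u)=u^{\theta_1-\theta_0}\frac{a_0(u)\|b_0\|_{\widetilde{E}_0(u,\infty)}}{a_1(u)\|b_1\|_{\widetilde{E}_1(u,\infty)}},\qquad u>0.$$ Then, for every $f\in\overline{X}^{\mathcal L}_{\theta_0,b_0,E_0,a_0,F_0}+\overline{X}^{\mathcal L}_{\theta_1,b_1,E_1,a_1,F_1}$ and every $u>0$, $$\begin{aligned}K\big(\rho(u),f;\overline{X}^{\mathcal L}_{\theta_0,b_0,E_0,a_0,F_0},\overline{X}^{\mathcal L}_{\theta_1,b_1,E_1,a_1,F_1}\big)\sim{}&\Big\|b_0(t)\|s^{-\theta_0}a_0(s)K(s,f)\|_{\widetilde{F}_0(0,t)}\Big\|_{\widetilde{E}_0(0,u)}\\&+\|b_0\|_{\widetilde{E}_0(u,\infty)}\,\|t^{-\theta_0}a_0(t)K(t,f)\|_{\widetilde{F}_0(0,u)}\\&+\rho(u)\Big\|b_1(t)\|s^{-\theta_1}a_1(s)K(s,f)\|_{\widetilde{F}_1(u,t)}\Big\|_{\widetilde{E}_1(u,\infty)},\end{aligned}$$ with equivalence constants independent of $f$ and $u$.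
   Context: R.i. spaces: an ''r.i. space'' $E$ is a rearrangement invariant Banach function space on $(0,\infty)$ (Lebesgue measure) with the Fatou property. $\widetilde{E}$ denotes the corresponding r.i. space with respect to the measure $dt/t$ on $(0,\infty)$: if $E=\mathcal F(L_1,L_\infty)$ for an interpolation functor $\mathcal F$, then $\widetilde{E}=\mathcal F(\widetilde L_1,L_\infty)$ with $\widetilde L_1=L_1((0,\infty),dt/t)$; concretely $\|f\|_{\widetilde E}=\|f^\star\|_E$, where $f^\star$ is the non-increasing rearrangement of $f$ with respect to $dt/t$. For an interval $I\subset(0,\infty)$, $\|f\|_{\widetilde E(I)}=\|f\chi_I\|_{\widetilde E}$. Slowly varying functions: a positive (finite) measurable function $b$ on $(0,\infty)$ belongs to $SV$ if for every $\varepsilon>0$, $t^{\varepsilon}b(t)$ is equivalent to a non-decreasing function and $t^{-\varepsilon}b(t)$ is equivalent to a non-increasing function on $(0,\infty)$. For a compatible (quasi-)Banach couple $(Y_0,Y_1)$, $K(t,f;Y_0,Y_1)=\inf\{\|f_0\|_{Y_0}+t\|f_1\|_{Y_1}: f=f_0+f_1,\ f_i\in Y_i\}$; write $K(t,f)=K(t,f;X_0,X_1)$. The space $\overline X^{\mathcal L}_{\theta,b,E,a,F}$ consists of all $f\in X_0+X_1$ with finite (quasi-)norm $\big\|b(t)\|s^{-\theta}a(s)K(s,f)\|_{\widetilde F(0,t)}\big\|_{\widetilde E}$. In nested norms the inner norm is taken in $s$ and the outer one in $t$. $A\sim B$ means $A\le cB$ and $B\le cA$ for some constant $c>0$. *)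

(* Defs.v *)
From HB Require Import structures.
From mathcomp Require Import all_boot all_order all_algebra.
From mathcomp Require Import all_classical all_reals all_analysis.
From mathcomp Require Import measurable_realfun.

Set Implicit Arguments.
Unset Strict Implicit.
Unset Printing Implicit Defensive.

Import Order.TTheory GRing.Theory Num.Theory.
Import numFieldNormedType.Exports.

Local Open Scope classical_set_scope.
Local Open Scope ring_scope.

(* A function on (0, +oo) is represented by a function on all of R; none of
   the definitions below depends on its values on ]-oo, 0]. *)

Definition posR (R : realType) : set R := `]0, +oo[.

Definition nneg_measurable (R : realType) (f : R -> \bar R) : Prop :=
  measurable_fun (@posR R) f /\ forall t, 0 < t -> (0 <= f t)%E.

Definition equimeasurable (R : realType) (f g : R -> \bar R) : Prop :=
  forall l : R, 0 <= l ->
    lebesgue_measure [set t : R | 0 < t /\ (l%:E < f t)%E] =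
    lebesgue_measure [set t : R | 0 < t /\ (l%:E < g t)%E].

(* Rearrangement invariant Banach function spaces on (0, +oo) with the Fatou
   property, given as in Bennett & Sharpley, "Interpolation of Operators",
   Ch. 1-2, by their function norm: the space is the set of all measurable f
   such that ri_norm |f| is finite.  The value of ri_norm on functions that are
   not nonnegative and measurable is irrelevant. *)
Record ri_space (R : realType) := RISpace {
  ri_norm :> (R -> \bar R) -> \bar R;
  ri_norm_ge0 : forall f, nneg_measurable f -> (0 <= ri_norm f)%E;
  ri_norm_eq0 : forall f, nneg_measurable f ->
    ri_norm f = 0%E <-> \forall t \ae (@lebesgue_measure R), 0 < t -> f t = 0%E;
  ri_normZ : forall (c : R) f, 0 <= c -> nneg_measurable f ->
    ri_norm (fun t => c%:E * f t)%E = (c%:E * ri_norm f)%E;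
  ri_normD : forall f g, nneg_measurable f -> nneg_measurable g ->
    (ri_norm (fun t => f t + g t) <= ri_norm f + ri_norm g)%E;
  ri_norm_le : forall f g, nneg_measurable f -> nneg_measurable g ->
    (\forall t \ae (@lebesgue_measure R), 0 < t -> (g t <= f t)%E) ->
    (ri_norm g <= ri_norm f)%E;
  ri_norm_fatou : forall (f_ : nat -> R -> \bar R) f,
    (forall n, nneg_measurable (f_ n)) -> nneg_measurable f ->
    (\forall t \ae (@lebesgue_measure R), 0 < t ->
      nondecreasing_seq (fun n => f_ n t) /\
      (f_ n t @[n --> \oo] --> f t)%classic) ->
    ri_norm (f_ n) @[n --> \oo] --> ri_norm f;
  ri_norm_indic : forall A : set R, measurable A -> A `<=` @posR R ->
    (lebesgue_measure A < +oo)%E ->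
    (ri_norm (fun t => (\1_A t)%:E) < +oo)%E;
  ri_norm_integral : forall A : set R, measurable A -> A `<=` @posR R ->
    (lebesgue_measure A < +oo)%E ->
    exists2 C : R, 0 < C & forall f, nneg_measurable f ->
      (\int[lebesgue_measure]_(t in A) f t <= C%:E * ri_norm f)%E;
  ri_norm_equimeasurable : forall f g, nneg_measurable f -> nneg_measurable g ->
    equimeasurable f g -> ri_norm f = ri_norm g
}.

(* The measure dt/t on (0, +oo). *)
Definition dtt (R : realType) (A : set R) : \bar R :=
  (\int[lebesgue_measure]_(s in A `&` @posR R) (s^-1)%:E)%E.

(* The non-increasing rearrangement with respect to dt/t. *)
Definition rearrangement_dtt (R : realType) (f : R -> \bar R) (t : R) : \bar R :=
  ereal_inf [set l : \bar R |
    (0 <= l)%E /\ (dtt [set s | (l < `|f s|)%E] <= t%:E)%E].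

(* The norm of E~(I), for a set I of positive reals; `f \_ I` is f on I and 0
   elsewhere. *)
Definition tilde_norm (R : realType) (E : ri_space R) (I : set R)
    (f : R -> \bar R) : \bar R :=
  E (rearrangement_dtt (f \_ I)).

Definition equiv_on_posR (R : realType) (f g : R -> R) : Prop :=
  exists2 c : R, 0 < c & forall t, 0 < t -> f t <= c * g t /\ g t <= c * f t.

Record slowly_varying (R : realType) (b : R -> R) : Prop := SlowlyVarying {
  sv_gt0 : forall t, 0 < t -> 0 < b t;
  sv_measurable : measurable_fun (@posR R) b;
  sv_nondecreasing : forall e, 0 < e ->
    exists2 g : R -> R, (forall s t, 0 < s -> s <= t -> g s <= g t) &
      equiv_on_posR (fun t => t `^ e * b t) g;
  sv_nonincreasing : forall e, 0 < e ->
    exists2 g : R -> R, (forall s t, 0 < s -> s <= t -> g t <= g s) &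
      equiv_on_posR (fun t => t `^ (- e) * b t) g
}.

(* A (quasi-)normed space contained in V is given by an extended (quasi-)norm
   N : V -> [0, +oo]; its elements are the vectors where N is finite. *)
Definition mem_space (R : realType) (V : Type) (N : V -> \bar R) : set V :=
  [set x | (N x < +oo)%E].

(* Quasi-Banach spaces continuously embedded in the topological vector space V
   (Banach spaces being the case where 1 is allowed as constant in qb_normD).
   Real scalars are no restriction: complex spaces are covered by restriction
   of scalars, which changes neither sums nor norms. *)
Record quasi_banach (R : realType) (V : topologicalLmodType R) := QuasiBanach {
  qb_norm :> V -> \bar R;
  qb_norm_ge0 : forall x, (0 <= qb_norm x)%E;
  qb_norm_eq0 : forall x, qb_norm x = 0%E <-> x = 0;
  qb_normZ : forall (c : R) x, qb_norm (c *: x) = (`|c|%:E * qb_norm x)%E;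
  qb_normD : exists2 C : R, 1 <= C & forall x y,
    (qb_norm (x + y)%R <= C%:E * (qb_norm x + qb_norm y))%E;
  qb_complete : forall x_ : nat -> V,
    (forall n, mem_space qb_norm (x_ n)) ->
    (forall e : R, 0 < e -> exists N, forall m n, (N <= m)%N -> (N <= n)%N ->
      (qb_norm (x_ m - x_ n)%R < e%:E)%E) ->
    exists2 x, mem_space qb_norm x &
      qb_norm (x_ n - x)%R @[n --> \oo] --> 0%E;
  qb_embedding : forall U : set V, nbhs (0 : V) U ->
    exists2 d : R, 0 < d & forall x, (qb_norm x < d%:E)%E -> U x
}.

Definition sum_space (R : realType) (V : zmodType) (N0 N1 : V -> \bar R) :
    set V :=
  [set f | exists f0 f1, [/\ mem_space N0 f0, mem_space N1 f1 & f = f0 + f1]].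

Definition Kfun (R : realType) (V : zmodType) (N0 N1 : V -> \bar R)
    (t : R) (f : V) : \bar R :=
  ereal_inf [set k | exists f0 f1,
    [/\ mem_space N0 f0, mem_space N1 f1, f = f0 + f1 &
        k = (N0 f0 + t%:E * N1 f1)%E]].

Definition weighted_K (R : realType) (V : zmodType) (X0 X1 : V -> \bar R)
    (theta : R) (a : R -> R) (f : V) (s : R) : \bar R :=
  ((s `^ (- theta) * a s)%:E * Kfun X0 X1 s f)%E.

(* The extended quasi-norm of the space X^L_{theta,b,E,a,F}. *)
Definition XL_norm (R : realType) (V : zmodType) (X0 X1 : V -> \bar R)
    (theta : R) (b : R -> R) (E : ri_space R) (a : R -> R) (F : ri_space R)
    (f : V) : \bar R :=
  if `[< sum_space X0 X1 f >] then
    tilde_norm E (@posR R) (fun t =>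
      (b t)%:E * tilde_norm F `]0%R, t[ (weighted_K X0 X1 theta a f))%E
  else +oo%E.

(* `fine` turns the norms into real numbers: under the hypotheses
   slowly_varying b and tilde_norm E `]1, +oo[ b < +oo, the norm of b on
   `]u, +oo[ is finite and positive for every u > 0. *)
Definition rho (R : realType) (theta0 theta1 : R) (E0 E1 : ri_space R)
    (a0 a1 b0 b1 : R -> R) (u : R) : R :=
  u `^ (theta1 - theta0) *
  ((a0 u * fine (tilde_norm E0 `]u, +oo[ (EFin \o b0))) /
   (a1 u * fine (tilde_norm E1 `]u, +oo[ (EFin \o b1)))).

(* Main.v *)
Require Import Defs.
From HB Require Import structures.
From mathcomp Require Import all_boot all_order all_algebra.
From mathcomp Require Import all_classical all_reals all_analysis.
From mathcomp Require Import measurable_realfun ring lra.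
Set Implicit Arguments.
Unset Strict Implicit.
Unset Printing Implicit Defensive.
Import Order.TTheory GRing.Theory Num.Theory.
Import numFieldNormedType.Exports.
Local Open Scope classical_set_scope.
Local Open Scope ring_scope.

(**
The functional [K] of the couple is equivalent to a sum of three terms because
both norms act on [f] through the function [k = K(., f)] only, and because the
two weights have different power exponents, so that every interaction between
the two spaces is a geometric tail, dominated by its value at [u].

The measure [dt / t].  The map [t |-> c * exp t] carries Lebesgue measure on
the half line to [dt / t] on [(c, +oo)] ([dtt_lebesgue]).  For functions
supported away from the origin the norm of the rearrangement is therefore a
norm of a composition ([rearrangement_norm]), and the Fatou property gives the
general case as a limit ([rearrangement_norm_cvg]).  Triangle inequality,
homogeneity and monotonicity follow, also for a factor [+oo], which occurs when
an inner norm is infinite ([tilde_normZe]).  Invariance under dilations shows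
that [exp (- e t)] has finite norm in every space ([expR_norm_fin]).

Weights.  It follows that [s ^ (- theta) * a s] on [(u, +oo)] and
[s ^ theta * a s] on [(0, u)] have norms bounded by a multiple of their values
at [u], for slowly varying [a] and [theta > 0] ([tilde_norm_tail],
[tilde_norm_head]).  The tail norm of a slowly varying function is again slowly
varying and dominates the function ([sv_tail_norm], [sv_le_tail_norm]).  As [k]
is quasi-concave, a norm over [(0, u)] of the weighted [k] dominates its value
at [u] ([weighted_le_head_norm]).

Upper estimate.  Take a decomposition [f = f0 + f1] which is optimal at [u] up
to a factor 2.  Then [K(s, f0)] is at most a multiple of [k (min s u)] and
[K(s, f1)] at most a multiple of the minimum of [k s] and [s / u * k u].
Splitting the norms at [u], the parts that contain [k u] are estimated by the
norms of weights and absorbed by the second term; the others are the first and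
the third ([upper_estimate]).

Lower estimate.  For an arbitrary decomposition, [k] is at most a multiple of
[K(., f0) + K(., f1)].  The norm of [f1] bounds [K(s, f1)] by a multiple of
[s ^ theta1] divided by [a1 s] and the tail norm of [b1]
([pointwise_le_outer_norm]); inserted in the first two terms this gives norms of
[s ^ (theta1 - theta0)] times a slowly varying function over [(0, u)], hence
[rho u] times the norm of [f1].  Exchanging the roles, [K(s, f0)] gives in the
third term a weight decaying on [(u, +oo)] ([lower_estimate]).
*)

(** * The measure dt / t in logarithmic coordinates *)

Section log_image.
Context {R : realType}.
Local Notation mu := (@lebesgue_measure R).

Lemma measurable_posR : measurable (@posR R).
Proof. exact: measurable_itv. Qed.

Lemma measurable_inv_posR : measurable_fun (@posR R) (fun s : R => s^-1).
Proof.
apply: open_continuous_measurable_fun; first exact: interval_open.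
move=> x; rewrite inE/= /posR /= in_itv/= andbT => x0.
by apply: inv_continuous; rewrite gt_eqF.
Qed.

Let logpre (c : R) (A : set R) : set R := [set s | A (ln (s / c))].

Let measurable_logpre (c : R) (A : set R) :
  measurable A -> measurable (logpre c A).
Proof.
move=> mA; rewrite -[X in measurable X]setTI.
have : measurable_fun [set: R] (fun s : R => ln (s / c)).
  apply: (measurable_comp measurableT) => //=.
  exact: mulrr_measurable.
by move=> /(_ measurableT A mA).
Qed.

(** The image of [dt / t] under [s |-> ln (s / c)], as a set function on the
    measurable type for which Lebesgue measure is characterized by its values
    on half-open intervals. *)
Definition log_measure (c : R) (A : set (measurableTypeR R)) : \bar R := dtt (logpre c A).

Let log_measure0 c : log_measure c set0 = 0%E.
Proof.
rewrite /log_measure /dtt (_ : _ `&` _ = set0) ?integral_set0//.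
by apply/seteqP; split=> s //= [].
Qed.

Lemma dtt_ge0 (A : set R) : (0 <= dtt A)%E.
Proof.
apply: integral_ge0 => s [_]; rewrite /posR/= in_itv/= andbT => s0.
by rewrite lee_fin invr_ge0 ltW.
Qed.

Let log_measure_ge0 c A : (0 <= log_measure c A)%E.
Proof. exact: dtt_ge0. Qed.

Let log_measure_sigma_additive c : semi_sigma_additive (log_measure c).
Proof.
move=> /= A mA tA mUA; rewrite /log_measure /dtt.
have -> : logpre c (\bigcup_n A n) `&` @posR R =
          \bigcup_n (logpre c (A n) `&` @posR R).
  apply/seteqP; split=> s.
    by move=> [[n _ An] ps]; exists n.
  by move=> [n _ [An ps]]; split => //; exists n.
rewrite ge0_integral_bigcup//=.
- apply: is_cvg_ereal_nneg_natsum_cond => n _ _; exact: log_measure_ge0.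
- by move=> k; exact: (measurableI _ _ (measurable_logpre c (mA k)) measurable_posR).
- apply/measurable_EFinP; apply: measurable_funS measurable_inv_posR.
    exact: measurable_posR.
  by move=> s [n _] [].
- by move=> s [n _] []; rewrite /posR/= in_itv/= andbT => _ s0;
    rewrite lee_fin invr_ge0 ltW.
- move=> i j _ _ [s] [] [] /= Ai _ [] Aj _; apply: (tA i j) => //.
  by exists (ln (s / c)).
Qed.

HB.instance Definition _ c := isMeasure.Build _ _ _
  (log_measure c) (log_measure0 c) (log_measure_ge0 c)
  (@log_measure_sigma_additive c).

Let log_measure_itv c (a b : R) : 0 < c -> a < b ->
  log_measure c `]a, b] = (b - a)%:E.
Proof.
move=> c0 ab; rewrite /log_measure /dtt.
have -> : logpre c `]a, b] `&` @posR R = `]c * expR a, c * expR b]%classic.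
  apply/seteqP; split=> s; rewrite /logpre /posR /=.
    rewrite !in_itv/= andbT => -[/andP[la lb] s0].
    have sc : s / c \is Num.pos by rewrite posrE divr_gt0.
    move: la lb; rewrite -ltr_expR -(ler_expR _ b) lnK//.
    by rewrite ltr_pdivlMr// ler_pdivrMr// ![expR _ * c]mulrC => -> ->.
  rewrite !in_itv/= andbT => /andP[la lb].
  have s0 : 0 < s by apply: lt_trans la; rewrite mulr_gt0// expR_gt0.
  have sc : s / c \is Num.pos by rewrite posrE divr_gt0.
  split=> //; rewrite -ltr_expR -(ler_expR _ b) lnK// ler_pdivrMr//.
  by rewrite ltr_pdivlMr// ![expR _ * c]mulrC la.
have ab' : c * expR a < c * expR b by rewrite ltr_pM2l// ltr_expR.
have ca0 : 0 < c * expR a by rewrite mulr_gt0// expR_gt0.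
have pos x : c * expR a <= x -> 0 < x by exact: lt_le_trans.
rewrite integral_itv_obnd_cbnd; last first.
  apply/measurable_EFinP; apply: measurable_funS measurable_inv_posR.
    exact: measurable_posR.
  by move=> s /=; rewrite /posR/= !in_itv/= andbT => /andP[/ltW/pos].
rewrite (@continuous_FTC2 _ _ (@ln R))//.
- by rewrite !lnM ?posrE ?expR_gt0// !expRK EFinB -EFinB; congr EFin; ring.
- apply: continuous_in_subspaceT => x; rewrite inE/= in_itv/= => /andP[/pos x0 _].
  by apply: inv_continuous; rewrite gt_eqF.
- split.
  + move=> x; rewrite in_itv/= => /andP[/ltW/pos x0 _].
    by have /@ex_derive := is_derive1_ln x0.
  + by apply: cvg_at_right_filter; exact: continuous_ln.
  + by apply: cvg_at_left_filter; apply: continuous_ln; exact: lt_trans ab'.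
- move=> x; rewrite in_itv/= => /andP[/ltW/pos x0 _].
  by rewrite derive1E; have /@derive_val := is_derive1_ln x0.
Qed.

(** The logarithm carries [dt / t] to Lebesgue measure, because the image
    measure gives [(a, b]] the mass [b - a].  Using an arbitrary scale [c]
    builds in the invariance of [dt / t] under dilations. *)
Lemma dtt_lebesgue (c : R) (S : set R) : 0 < c -> measurable S ->
  dtt S = mu [set x : R | S (c * expR x)].
Proof.
move=> c0 mS.
have mT : measurable [set x : R | S (c * expR x)].
  have : measurable_fun [set: R] (fun x : R => c * expR x).
    by apply: (measurable_comp measurableT) => //=; exact: mulrl_measurable.
  by move=> /(_ measurableT S mS); rewrite setTI.
rewrite (@lebesgue_measure_unique R (log_measure c))//.
  rewrite /log_measure /dtt; congr (integral _ _ _).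
  apply/seteqP; split=> s []; rewrite /logpre /posR /= in_itv/= andbT.
    move=> Ss s0; split => //; rewrite lnK ?posrE ?divr_gt0//.
    by rewrite mulrC mulfVK ?gt_eqF.
  move=> + s0; rewrite lnK ?posrE ?divr_gt0//.
  by rewrite mulrC mulfVK ?gt_eqF.
move=> X [[a b] _ <-] /=; rewrite lebesgue_measure_itv/= lte_fin.
case: ltP => ab; first by rewrite log_measure_itv.
by rewrite set_itv_ge ?measure0// bnd_simp -leNgt.
Qed.

End log_image.

(** * Rearrangements with respect to dt / t *)

Section rearrangement.
Context {R : realType}.
Local Notation mu := (@lebesgue_measure R).
Implicit Types (f g : R -> \bar R) (S : set R) (y : \bar R).

Lemma measurable_expR_preimage (c : R) S : measurable S ->
  measurable [set x : R | S (c * expR x)].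
Proof.
move=> mS; have : measurable_fun [set: R] (fun x : R => c * expR x).
  by apply: (measurable_comp measurableT) => //=; exact: mulrl_measurable.
by move=> /(_ measurableT S mS); rewrite setTI.
Qed.

Lemma le_dtt S T : measurable S -> measurable T -> S `<=` T ->
  (dtt S <= dtt T)%E.
Proof.
move=> mS mT ST; rewrite !(dtt_lebesgue (ltr01 : 0 < 1 :> R))//.
apply: le_measure; rewrite ?inE; try exact: measurable_expR_preimage.
by move=> x; exact: ST.
Qed.

Lemma dtt_bigcup_gt (S : nat -> set R) (t : \bar R) :
  (forall n, measurable (S n)) -> nondecreasing_seq S ->
  (t < dtt (\bigcup_n S n))%E -> exists n, (t < dtt (S n))%E.
Proof.
move=> mS ndS tlt; apply: contrapT => /forallNP tge.
pose T n := [set x : R | S n (1 * expR x)].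
have mT n : measurable (T n) by exact: measurable_expR_preimage.
have ndT : nondecreasing_seq T.
  by move=> m n /ndS /subsetPset mn; apply/subsetPset => x; exact: mn.
have := @nondecreasing_cvg_mu _ _ _ mu T mT (bigcupT_measurable T mT) ndT.
move=> cT; have : (mu (\bigcup_n T n) <= t)%E.
  have /cvg_lim <- // := cT.
  apply: lime_le; first by apply/cvg_ex; eexists; exact: cT.
  by apply: nearW => n; rewrite /= -dtt_lebesgue// leNgt; apply/negP/tge.
apply/negP; rewrite -ltNge; move: tlt.
by rewrite (dtt_lebesgue (ltr01 : 0 < 1 :> R))//; exact: bigcupT_measurable.
Qed.

Definition level_set f y : set R := [set s | 0 < s /\ (y < f s)%E].

Lemma measurable_level_set f y : nneg_measurable f -> measurable (level_set f y).
Proof.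
move=> [mf _]; have := emeasurable_fun_o_infty measurable_posR mf y.
congr measurable; apply/seteqP.
by split=> s /=; rewrite /posR/= in_itv/= andbT.
Qed.

Lemma dtt_level_abs f y : nneg_measurable f ->
  dtt [set s | (y < `|f s|)%E] = dtt (level_set f y).
Proof.
move=> [_ f0]; congr (integral _ _ _).
apply/seteqP; split=> s; rewrite /posR /level_set/= in_itv/= andbT.
  by move=> -[yf s0]; rewrite -(gee0_abs (f0 _ s0)).
by move=> -[[s0 yf] _]; rewrite (gee0_abs (f0 _ s0)).
Qed.

(** The level sets over [l + 1 / (n + 1)] increase to the one over [l].  If the
    latter has measure larger than [t], so has one of the former, and then no
    value below [l + 1 / (n + 1)] competes in the infimum defining the
    rearrangement. *)
Lemma lt_rearrangement f (l t : R) : nneg_measurable f -> 0 <= l ->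
  (l%:E < rearrangement_dtt f t)%E = (t%:E < dtt (level_set f l%:E))%E.
Proof.
move=> nf l0; apply/idP/idP => [lt|].
  rewrite ltNge; apply: contraTN lt => le; rewrite -leNgt.
  by apply: ereal_inf_lbound; split; rewrite ?lee_fin//= dtt_level_abs.
pose S n := level_set f (l + n.+1%:R^-1)%:E.
have mS n : measurable (S n) by exact: measurable_level_set.
have ndS : nondecreasing_seq S.
  move=> m n mn; apply/subsetPset => s [s0 ms]; split => //.
  by apply: le_lt_trans ms; rewrite lee_fin lerD2l lef_pV2 ?posrE// ler_nat.
have -> : level_set f l%:E = \bigcup_n S n.
  apply/seteqP; split=> s; last first.
    move=> [n _ [s0 ns]]; split => //; apply: lt_trans ns.
    by rewrite lte_fin ltrDl invr_gt0.
  move=> -[s0 ls]; suff [n nf'] : exists n, ((l + n.+1%:R^-1)%:E < f s)%E.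
    by exists n.
  case: (f s) ls => [r| |//]; last by exists 0%N; rewrite ltry.
  rewrite lte_fin => lr.
  exists `|Num.ceil (r - l)^-1|%N; rewrite lte_fin -ltrBrDl.
  have rl : 0 < r - l by rewrite subr_gt0.
  rewrite invf_plt ?posrE//.
  apply: (le_lt_trans (ceil_ge _)); rewrite -natr1 ltr_pwDr//.
  by rewrite natr_absz ler_int ler_norm.
move=> /dtt_bigcup_gt-/(_ mS ndS)[n tn].
apply: (@lt_le_trans _ _ (l + n.+1%:R^-1)%:E); first by rewrite lte_fin ltrDl invr_gt0.
apply: le_ereal_inf_tmp => y [y0]; rewrite dtt_level_abs//.
apply: contra_leP => /negP; rewrite -ltNge => yl.
apply: (lt_le_trans tn); apply: le_dtt; [exact: mS|exact: measurable_level_set|].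
by move=> s [s0 ns]; split => //; exact: (lt_trans yl ns).
Qed.

Lemma rearrangement_ge0 f (t : R) : (0 <= rearrangement_dtt f t)%E.
Proof. by apply: le_ereal_inf_tmp => y []. Qed.

Lemma rearrangement_anti f (s t : R) : s <= t ->
  (rearrangement_dtt f t <= rearrangement_dtt f s)%E.
Proof.
move=> st; apply: ereal_inf_le_tmp => y /= [y0 ys]; split => //.
by rewrite (le_trans ys)// lee_fin.
Qed.

Lemma monotone_measurable_posR (g : R -> \bar R) :
  (forall s t, 0 < s -> s <= t -> (g s <= g t)%E) \/
  (forall s t, 0 < s -> s <= t -> (g t <= g s)%E) ->
  measurable_fun (@posR R) g.
Proof.
move=> gm; apply: (measurability (@ErealGenOInfty.G R)).
  exact: ErealGenOInfty.measurableE.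
move=> _ [_ [y ->] <-]; apply: is_interval_measurable => s t /=.
rewrite /posR/= !in_itv/= !andbT => -[s0 ys] [t0 yt] u /andP[su ut].
have u0 : 0 < u by exact: lt_le_trans su.
rewrite in_itv/= !andbT; split => //.
move: ys yt; rewrite ?in_itv/= ?andbT => ys yt.
by case: gm => gm; [apply: (lt_le_trans ys)|apply: (lt_le_trans yt)]; exact: gm.
Qed.

Lemma nneg_measurable_rearrangement f : nneg_measurable (rearrangement_dtt f).
Proof.
split=> [|t _]; last exact: rearrangement_ge0.
apply: monotone_measurable_posR; right => s t _; exact: rearrangement_anti.
Qed.

(** A function and its rearrangement are equimeasurable: by [lt_rearrangement]
    the level sets of the rearrangement are intervals starting at the origin,
    of the right length. *)
Lemma level_set_rearrangement f (l : R) : nneg_measurable f -> 0 <= l ->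
  mu (level_set (rearrangement_dtt f) l%:E) = dtt (level_set f l%:E).
Proof.
move=> nf l0.
have -> : level_set (rearrangement_dtt f) l%:E =
    [set t | 0 < t /\ (t%:E < dtt (level_set f l%:E))%E].
  by apply/seteqP; split=> t [t0 h]; split => //; move: h; rewrite lt_rearrangement.
have := dtt_ge0 (level_set f l%:E).
case: (dtt (level_set f l%:E)) => [d| |//] d0.
  rewrite (_ : [set _ | _] = `]0, d[%classic); last first.
    apply/seteqP; split=> t /=; rewrite in_itv/= lte_fin; first by move=> [-> ->].
    by move=> /andP[].
  rewrite lebesgue_measure_itv/= lte_fin; case: ltP => [_|]; first by rewrite sube0.
  by rewrite lee_fin in d0 => d0'; congr EFin; apply/eqP; rewrite eq_le d0 d0'.
rewrite (_ : [set _ | _] = `]0, +oo[%classic).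
  by rewrite lebesgue_measure_itv/= ltry.
by apply/seteqP; split=> t /=; rewrite in_itv/= andbT ?ltry //= => -[].
Qed.

End rearrangement.

(** * Norms of rearrangements as norms in the logarithmic variable *)

Section norm_transfer.
Context {R : realType} (E : ri_space R).
Local Notation mu := (@lebesgue_measure R).
Implicit Types (f g : R -> \bar R).

Lemma ri_norm_eq f g : nneg_measurable f -> nneg_measurable g ->
  (forall t, 0 < t -> f t = g t) -> E f = E g.
Proof.
move=> mf mg fg; apply/eqP; rewrite eq_le; apply/andP; split.
  by apply: ri_norm_le => //; apply: aeW => t t0; rewrite fg.
by apply: ri_norm_le => //; apply: aeW => t t0; rewrite fg.
Qed.

Lemma nneg_measurable_expR f (c : R) : 0 < c -> nneg_measurable f ->
  nneg_measurable (fun t => f (c * expR t)).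
Proof.
move=> c0 [mf f0]; split=> [|t t0]; last by apply: f0; rewrite mulr_gt0 ?expR_gt0.
apply: (measurable_comp (@measurable_posR R) _ mf).
  by move=> _ [t _ <-]; rewrite /posR/= in_itv/= andbT mulr_gt0 ?expR_gt0.
apply: measurable_funTS; apply: (measurable_comp measurableT) => //=.
Qed.

(** [t |-> c * expR t] maps the half line with Lebesgue measure onto
    [(c, +oo)] with [dt / t] and preserves the measures, so for a function
    supported there it does the work of the rearrangement. *)
Lemma rearrangement_norm f (c : R) : 0 < c -> nneg_measurable f ->
  (forall s, 0 < s -> s <= c -> f s = 0%E) ->
  E (rearrangement_dtt f) = E (fun t => f (c * expR t)).
Proof.
move=> c0 nf fc0; apply: ri_norm_equimeasurable.
- exact: nneg_measurable_rearrangement.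
- exact: nneg_measurable_expR.
move=> l l0; have := level_set_rearrangement nf l0.
rewrite /level_set => ->; rewrite (@dtt_lebesgue _ c)//.
  congr (mu _); apply/seteqP; split=> x [] /= x0 lx.
    split => //; rewrite ltNge; apply/negP => x0'.
    move: lx; rewrite fc0 ?lte_fin//; first by rewrite ltNge l0.
    by rewrite -[leRHS]mulr1 ler_pM2l// expR_le1.
  by split => //; rewrite mulr_gt0 ?expR_gt0.
exact: measurable_level_set.
Qed.

Lemma le_rearrangement f g (t : R) : nneg_measurable f -> nneg_measurable g ->
  (forall s, 0 < s -> (f s <= g s)%E) ->
  (rearrangement_dtt f t <= rearrangement_dtt g t)%E.
Proof.
move=> nf ng fg; apply: ereal_inf_le_tmp => y /= [y0].
rewrite !dtt_level_abs// => yt; split => //; apply: le_trans yt.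
apply: le_dtt; [exact: measurable_level_set|exact: measurable_level_set|].
by move=> s [s0 ys]; split => //; exact: lt_le_trans (fg _ s0).
Qed.

Lemma nneg_measurable_restrict (I : set R) f : measurable I -> I `<=` @posR R ->
  measurable_fun I f -> (forall s, I s -> (0 <= f s)%E) ->
  nneg_measurable (f \_ I).
Proof.
move=> mI Ipos mf f0; split.
  apply/measurable_restrict => //; first exact: measurable_posR.
  by apply: measurable_funS mf => // s [].
by move=> s _; rewrite patchE; case: ifPn => // /[!inE] /f0.
Qed.

(** Functions supported away from the origin are transported to the half line
    by the logarithm; by the Fatou property their norms determine all others,
    which turns the norm axioms for [E] into norm axioms with respect to
    [dt / t]. *)
Lemma rearrangement_norm_cvg f : nneg_measurable f ->
  E (fun t => f (n.+1%:R^-1 * expR t)) @[n --> \oo] --> E (rearrangement_dtt f).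
Proof.
move=> nf.
pose I n := `]n.+1%:R^-1 : R, +oo[%classic.
have c0 n : 0 < n.+1%:R^-1 :> R by rewrite invr_gt0.
have Ipos n : I n `<=` @posR R.
  move=> s; rewrite /I /posR/= !in_itv/= !andbT; exact: lt_trans.
have nfI n : nneg_measurable (f \_ (I n)).
  case: (nf) => mf f0; apply: nneg_measurable_restrict => //.
  + exact: measurable_itv.
  + by apply: measurable_funS mf; [exact: measurable_posR|exact: Ipos].
  + by move=> s /Ipos; rewrite /posR/= in_itv/= andbT; exact: f0.
have -> : (fun n => E (fun t => f (n.+1%:R^-1 * expR t))) =
    (fun n => E (rearrangement_dtt (f \_ (I n)))).
  apply/funext => n; rewrite (rearrangement_norm (c0 n))//.
    apply: ri_norm_eq; [exact: nneg_measurable_expR|exact: nneg_measurable_expR|].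
    move=> t t0; rewrite patchE ifT// inE /I/= in_itv/= andbT.
    by rewrite ltr_pMr// expR_gt1.
  move=> s _ sn; rewrite patchE ifF//; apply/negP; rewrite inE /I/= in_itv/= andbT.
  by rewrite ltNge sn.
apply: ri_norm_fatou.
- by move=> n; exact: nneg_measurable_rearrangement.
- exact: nneg_measurable_rearrangement.
apply: aeW => t t0.
have nd : nondecreasing_seq (fun n => rearrangement_dtt (f \_ (I n)) t).
  move=> m n mn; apply: le_rearrangement => // s s0.
  rewrite !patchE; case: ifPn => [|_]; last by case: ifPn => // _; exact: nf.2.
  rewrite inE /I/= in_itv/= andbT => ms; rewrite ifT// inE/= in_itv/= andbT.
  by apply: le_lt_trans ms; rewrite lef_pV2 ?posrE// ler_nat.
split => //; have := ereal_nondecreasing_cvgn nd.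
suff -> : ereal_sup (range (fun n => rearrangement_dtt (f \_ (I n)) t)) =
    rearrangement_dtt f t by [].
apply/eqP; rewrite eq_le; apply/andP; split.
  apply: ge_ereal_sup => _ [n _ <-]; apply: le_rearrangement => // s s0.
  by rewrite patchE; case: ifPn => // _; exact: nf.2.
rewrite leNgt; apply/negP.
have sup_ge n : (rearrangement_dtt (f \_ (I n)) t <=
    ereal_sup (range (fun n => rearrangement_dtt (f \_ (I n)) t)))%E.
  by apply: ereal_sup_ubound; exists n.
move: sup_ge; set M := ereal_sup _ => sup_ge.
have : (0 <= M)%E by apply: le_trans (sup_ge 0%N); exact: rearrangement_ge0.
case: M sup_ge => [l| |//] sup_ge; last by move=> _; apply/negP; rewrite -leNgt leey.
rewrite lee_fin => l0; rewrite lt_rearrangement//.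
have -> : level_set f l%:E = \bigcup_n level_set (f \_ (I n)) l%:E.
  apply/seteqP; split=> s.
    move=> [s0 ls]; exists `|Num.ceil s^-1|%N => //; split => //.
    rewrite patchE ifT// inE /I/= in_itv/= andbT invf_plt ?posrE//.
    apply: (le_lt_trans (ceil_ge _)); rewrite -natr1 ltr_pwDr//.
    by rewrite natr_absz ler_int ler_norm.
  move=> [n _ [s0]]; rewrite patchE; case: ifPn => [_ ls|_ h]; first by [].
  by exfalso; move: h; rewrite lte_fin ltNge l0.
move=> /dtt_bigcup_gt[].
- by move=> n; exact: measurable_level_set.
- move=> m n mn; apply/subsetPset => s [s0].
  rewrite !patchE; case: ifPn => [|_ h]; last first.
    by exfalso; move: h; rewrite lte_fin ltNge l0.
  rewrite inE /I/= in_itv/= andbT => ms ls; split => //.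
  rewrite patchE ifT// inE/= in_itv/= andbT.
  by apply: le_lt_trans ms; rewrite lef_pV2 ?posrE// ler_nat.
- move=> n; rewrite -lt_rearrangement// => h.
  by have := lt_le_trans h (sup_ge n); rewrite ltxx.
Qed.

End norm_transfer.

(** * Norm axioms with respect to dt / t *)

Section tilde_norm_theory.
Context {R : realType} (E : ri_space R).
Implicit Types (f g h : R -> \bar R) (I J K : set R).

Let c0 n : 0 < n.+1%:R^-1 :> R. Proof. by rewrite invr_gt0. Qed.

(** The exceptional point [u] allows intervals to be cut at [u] into two open
    ones. *)
Lemma rearrangement_norm_le f g (u : R) :
  nneg_measurable f -> nneg_measurable g ->
  (forall s, 0 < s -> s != u -> (f s <= g s)%E) ->
  (E (rearrangement_dtt f) <= E (rearrangement_dtt g))%E.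
Proof.
move=> nf ng fg.
apply: (lee_cvg_to (@rearrangement_norm_cvg _ E _ nf) (@rearrangement_norm_cvg _ E _ ng)).
apply: nearW => n; apply: ri_norm_le; [exact: nneg_measurable_expR|exact: nneg_measurable_expR|].
exists [set ln (u * n.+1%:R)]; split => //=.
  exact: lebesgue_measure_set1.
move=> t /= /not_implyP[t0 /negP]; rewrite -ltNge => gf.
apply: contrapT => tu; move: gf; apply/negP; rewrite -leNgt; apply: fg.
  by rewrite mulr_gt0 ?expR_gt0.
apply/eqP => ue; apply: tu; rewrite -ue mulrC mulrA mulfV ?pnatr_eq0// mul1r.
by rewrite expRK.
Qed.

Lemma nneg_measurableD f g : nneg_measurable f -> nneg_measurable g ->
  nneg_measurable (fun t => f t + g t)%E.
Proof.
move=> [mf f0] [mg g0]; split; first exact: emeasurable_funD.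
by move=> t t0; rewrite adde_ge0 ?f0 ?g0.
Qed.

Lemma nneg_measurableZ (c : R) f : 0 <= c -> nneg_measurable f ->
  nneg_measurable (fun t => c%:E * f t)%E.
Proof.
move=> c_ge0 [mf f0]; split; first exact: measurable_funeM.
by move=> t t0; rewrite mule_ge0 ?f0.
Qed.

Lemma rearrangement_normD f g : nneg_measurable f -> nneg_measurable g ->
  (E (rearrangement_dtt (fun s => f s + g s)%E) <=
   E (rearrangement_dtt f) + E (rearrangement_dtt g))%E.
Proof.
move=> nf ng.
have nfg := nneg_measurableD nf ng.
have N0 h : (0 <= E (rearrangement_dtt h))%E.
  by apply: ri_norm_ge0; exact: nneg_measurable_rearrangement.
have cD : (fun n => E (fun t => f (n.+1%:R^-1 * expR t)%R) +
      E (fun t => g (n.+1%:R^-1 * expR t)%R))%E @ \oo -->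
    (E (rearrangement_dtt f) + E (rearrangement_dtt g))%E.
  apply: cvgeD; [|exact: rearrangement_norm_cvg|exact: rearrangement_norm_cvg].
  by apply: ge0_adde_def; rewrite inE.
apply: (lee_cvg_to (@rearrangement_norm_cvg _ E _ nfg) cD).
by apply: nearW => n; apply: ri_normD; exact: nneg_measurable_expR.
Qed.

Lemma rearrangement_normZ (c : R) f : 0 <= c -> nneg_measurable f ->
  E (rearrangement_dtt (fun s => c%:E * f s)%E) =
  (c%:E * E (rearrangement_dtt f))%E.
Proof.
move=> c_ge0 nf.
have := @rearrangement_norm_cvg _ E _ (nneg_measurableZ c_ge0 nf).
have -> : (fun n => E (fun t => c%:E * f (n.+1%:R^-1 * expR t)%R)%E) =
    (fun n => c%:E * E (fun t => f (n.+1%:R^-1 * expR t)%R))%E.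
  by apply/funext => n; rewrite ri_normZ//; exact: nneg_measurable_expR.
move=> c1.
have c2 : (fun n => c%:E * E (fun t => f (n.+1%:R^-1 * expR t)%R))%E @ \oo -->
    (c%:E * E (rearrangement_dtt f))%E.
  by apply: (cvgeZl (isT : c%:E \is a fin_num)); exact: rearrangement_norm_cvg.
by move: c1 c2 => /cvg_lim <- // /cvg_lim <-.
Qed.

Definition pos_measurable I := measurable I /\ I `<=` @posR R.

Definition nneg_measurable_on I f :=
  measurable_fun I f /\ forall s, I s -> (0 <= f s)%E.

Lemma nneg_measurable_onS I J f : pos_measurable J -> I `<=` J ->
  nneg_measurable_on J f -> nneg_measurable_on I f.
Proof.
move=> [mJ _] IJ [mf f0]; split; first exact: measurable_funS mf.
by move=> s /IJ; exact: f0.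
Qed.

Lemma nneg_measurable_on_restrict I f : pos_measurable I ->
  nneg_measurable_on I f -> nneg_measurable (f \_ I).
Proof. by move=> [mI Ip] [mf f0]; exact: nneg_measurable_restrict. Qed.

Lemma restrict_ge0 I f s : nneg_measurable_on I f -> (0 <= (f \_ I) s)%E.
Proof. by move=> [_ f0]; rewrite patchE; case: ifPn => // /[!inE] /f0. Qed.

Lemma tilde_norm_ge0 I f : (0 <= tilde_norm E I f)%E.
Proof. by apply: ri_norm_ge0; exact: nneg_measurable_rearrangement. Qed.

Lemma tilde_norm_ext I f g : (forall s, I s -> f s = g s) ->
  tilde_norm E I f = tilde_norm E I g.
Proof.
move=> fg; congr (E (rearrangement_dtt _)); apply/funext => s; rewrite !patchE.
by case: ifPn => // /[!inE] /fg.
Qed.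

Lemma tilde_norm_le_split I J K f g h (u : R) :
  pos_measurable I -> pos_measurable J -> pos_measurable K ->
  nneg_measurable_on I f -> nneg_measurable_on J g -> nneg_measurable_on K h ->
  (forall s, I s -> s != u -> (f s <= (g \_ J) s + (h \_ K) s)%E) ->
  (tilde_norm E I f <= tilde_norm E J g + tilde_norm E K h)%E.
Proof.
move=> pI pJ pK nf ng nh fgh.
have rf := nneg_measurable_on_restrict pI nf.
have rg := nneg_measurable_on_restrict pJ ng.
have rh := nneg_measurable_on_restrict pK nh.
apply: le_trans (rearrangement_normD rg rh).
apply: (@rearrangement_norm_le _ _ u) => //; first exact: nneg_measurableD.
move=> s s0 su; rewrite [X in (X <= _)%E]patchE; case: ifPn.
  by rewrite inE => /fgh; exact.
by move=> _; rewrite adde_ge0// restrict_ge0.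
Qed.

Lemma tilde_norm_cover I J K f (u : R) :
  pos_measurable I -> pos_measurable J -> pos_measurable K ->
  nneg_measurable_on I f -> nneg_measurable_on J f -> nneg_measurable_on K f ->
  (forall s, I s -> s != u -> J s \/ K s) ->
  (tilde_norm E I f <= tilde_norm E J f + tilde_norm E K f)%E.
Proof.
move=> pI pJ pK nI nJ nK IJK; apply: (@tilde_norm_le_split _ _ _ _ _ _ u) => //.
move=> s Is /(IJK _ Is) [Js|Ks].
  by rewrite [X in (_ <= X + _)%E]patchE mem_set// leeDl// restrict_ge0.
by rewrite [X in (_ <= _ + X)%E]patchE mem_set// leeDr// restrict_ge0.
Qed.

Lemma le_tilde_norm I J f g : pos_measurable I -> pos_measurable J ->
  nneg_measurable_on I f -> nneg_measurable_on J g -> I `<=` J ->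
  (forall s, I s -> (f s <= g s)%E) ->
  (tilde_norm E I f <= tilde_norm E J g)%E.
Proof.
move=> pI pJ nf ng IJ fg.
apply: (@rearrangement_norm_le _ _ 0) => //; try exact: nneg_measurable_on_restrict.
move=> s _ _; rewrite [X in (X <= _)%E]patchE; case: ifPn.
  by rewrite inE => Is; rewrite patchE mem_set; [exact: fg|exact: IJ].
by move=> _; exact: restrict_ge0.
Qed.

Lemma tilde_normD I f g : pos_measurable I ->
  nneg_measurable_on I f -> nneg_measurable_on I g ->
  (tilde_norm E I (fun s => f s + g s) <=
   tilde_norm E I f + tilde_norm E I g)%E.
Proof.
move=> pI nf ng; apply: (@tilde_norm_le_split _ _ _ _ _ _ 0) => //.
  case: nf ng => mf f0 [mg g0]; split; first exact: emeasurable_funD.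
  by move=> s Is; rewrite adde_ge0 ?f0 ?g0.
by move=> s Is _; rewrite !patchE mem_set.
Qed.

Lemma tilde_normZ (c : R) I f : 0 <= c -> pos_measurable I ->
  nneg_measurable_on I f ->
  tilde_norm E I (fun s => c%:E * f s)%E = (c%:E * tilde_norm E I f)%E.
Proof.
move=> c_ge0 pI nf; rewrite /tilde_norm
  -(rearrangement_normZ c_ge0 (nneg_measurable_on_restrict pI nf)).
congr (E (rearrangement_dtt _)); apply/funext => s; rewrite !patchE.
by case: ifPn => //; rewrite mule0.
Qed.

Lemma nneg_measurable_onZ (c : \bar R) I f : (0 <= c)%E ->
  nneg_measurable_on I f -> nneg_measurable_on I (fun s => c * f s)%E.
Proof.
move=> c_ge0 [mf f0]; split; first exact: measurable_funeM.
by move=> s Is; rewrite mule_ge0 ?f0.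
Qed.

(** Homogeneity persists for an infinite factor as long as the function is not
    negligible: the norm of [+oo * f] exceeds every multiple of that of [f]. *)
Lemma tilde_normZe (c : \bar R) I f : (0 <= c)%E -> pos_measurable I ->
  nneg_measurable_on I f -> (0 < tilde_norm E I f)%E ->
  tilde_norm E I (fun s => c * f s)%E = (c * tilde_norm E I f)%E.
Proof.
move=> + pI nf Nf; case: c => [c| |//] c_ge0; first exact: tilde_normZ.
rewrite gt0_mulye//.
have le_mul n : (n%:R%:E * tilde_norm E I f <=
    tilde_norm E I (fun s => +oo * f s))%E.
  rewrite -(tilde_normZ (ler0n _ n) pI nf).
  apply: (le_tilde_norm pI pI) => //.
  - exact: nneg_measurable_onZ.
  - exact: nneg_measurable_onZ.
  - move=> s Is; have := nf.2 _ Is; rewrite le_eqVlt => /predU1P[<-|fs].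
      by rewrite !mule0.
    by rewrite gt0_mulye// leey.
apply/eqP; rewrite eq_le leey/=.
have [Ny|Nfin] := eqVneq (tilde_norm E I f) +oo%E.
  by have := le_mul 1%N; rewrite Ny gt0_muley ?lte_fin.
have /fineK Nr : tilde_norm E I f \is a fin_num by rewrite ge0_fin_numE ?ltey ?(ltW Nf).
move: Nf le_mul; rewrite -Nr lte_fin.
set r := fine _ => r0; case: (tilde_norm E I _) => [x| |] le_mul //.
- have := le_mul (`|Num.ceil (x / r)|.+1); rewrite lee_fin leNgt => /negP[].
  rewrite -ltr_pdivrMr//; apply: (le_lt_trans (ceil_ge _)).
  by rewrite -natr1 ltr_pwDr// natr_absz ler_int ler_norm.
- by have := le_mul 0%N; rewrite mul0e.
Qed.

End tilde_norm_theory.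

(** * Norms of powers *)

Section power_norms.
Context {R : realType} (E : ri_space R).
Local Notation mu := (@lebesgue_measure R).
Implicit Types (f g h : R -> \bar R) (I J K : set R).

Lemma pos_measurable_posR : pos_measurable (@posR R).
Proof. by split => //; exact: measurable_posR. Qed.

Lemma pos_measurable_oo (a b : R) : 0 <= a -> pos_measurable `]a, b[.
Proof.
move=> a0; split; first exact: measurable_itv.
by move=> s; rewrite /posR/= !in_itv/= andbT => /andP[/(le_lt_trans a0)].
Qed.

Lemma pos_measurable_oy (a : R) : 0 <= a -> pos_measurable `]a, +oo[.
Proof.
move=> a0; split; first exact: measurable_itv.
by move=> s; rewrite /posR/= !in_itv/= !andbT => /(le_lt_trans a0).
Qed.

Lemma expR_powR (x e : R) : expR x `^ e = expR (e * x).
Proof. by rewrite /powR gt_eqF ?expR_gt0// expRK. Qed.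

Lemma nneg_measurable_expRM (x : R) :
  nneg_measurable (fun t => (expR (x * t))%:E).
Proof.
split; last by move=> t _; rewrite lee_fin expR_ge0.
apply/measurable_EFinP; apply: measurable_funTS.
by apply: (measurable_comp measurableT) => //=; exact: mulrl_measurable.
Qed.

Lemma tilde_norm_expR (a : R) I f : 0 < a -> I `<=` `]a, +oo[ ->
  pos_measurable I -> nneg_measurable_on I f ->
  tilde_norm E I f = E (fun t => (f \_ I) (a * expR t)).
Proof.
move=> a0 Ia pI nf; apply: rearrangement_norm => //.
  exact: nneg_measurable_on_restrict.
move=> s _ sa; rewrite patchE; case: ifPn => // /[!inE] /Ia.
by rewrite /= in_itv/= andbT ltNge sa.
Qed.

Lemma nneg_measurable_on_EFin I (w : R -> R) : measurable_fun I w ->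
  (forall s, I s -> 0 <= w s) -> nneg_measurable_on I (EFin \o w).
Proof.
move=> mw w0; split; first exact/measurable_EFinP.
by move=> s Is; rewrite lee_fin w0.
Qed.

Lemma nneg_measurable_on_cst I (r : R) : 0 <= r ->
  nneg_measurable_on I (cst r%:E).
Proof. by move=> r0; split => // s _ /=; rewrite lee_fin. Qed.

(** The intervals [(a, c a)] are dilates of each other, so that the norms of
    their indicators agree; the common value is that of [(0, ln c)] in [E]. *)
Lemma tilde_norm1 (c : R) : 1 < c -> exists2 m : R, 0 < m &
  forall a, 0 < a -> tilde_norm E `]a, c * a[ (cst 1%:E) = m%:E.
Proof.
move=> c1.
have c0 : 0 < c by exact: lt_trans c1.
pose A : set R := `]0, ln c[%classic.
have mA : measurable A by exact: measurable_itv.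
have A0 : A `<=` @posR R by exact: (pos_measurable_oo _ (lexx 0)).2.
have muA : mu A = (ln c)%:E by rewrite lebesgue_measure_itv/= lte_fin ln_gt0// sube0.
have nA : nneg_measurable (fun t => (\1_A t)%:E : \bar R).
  split; last by move=> t _; rewrite lee_fin.
  by apply/measurable_EFinP; exact: measurable_indic.
have Afin : E (fun t => (\1_A t)%:E) \is a fin_num.
  rewrite ge0_fin_numE ?ri_norm_ge0//; apply: ri_norm_indic => //.
  by rewrite muA ltry.
exists (fine (E (fun t => (\1_A t)%:E))).
  rewrite -lte_fin fineK// lt_neqAle ri_norm_ge0// andbT eq_sym.
  apply/eqP => /(ri_norm_eq0 E nA)[N [mN N0 AN]].
  have : (mu A <= mu N)%E.
    apply: le_measure; rewrite ?inE//.
    move=> t At; apply: AN => /=; move: (A0 _ At).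
    rewrite /posR/= in_itv/= andbT => t0 /(_ t0); rewrite indicE mem_set//=.
    by move=> [] /eqP; rewrite oner_eq0.
  by rewrite N0 muA lee_fin leNgt ln_gt0.
move=> a a0; rewrite fineK// (@tilde_norm_expR a)//.
- congr (ri_norm E _); apply/funext => t; rewrite patchE indicE.
  have -> : (a * expR t \in `]a, c * a[%classic) = (t \in A).
    have e1 : (a < a * expR t) = (0 < t) by rewrite ltr_pMr// expR_gt1.
    have e2 : (a * expR t < c * a) = (t < ln c).
      by rewrite mulrC ltr_pM2r// -[X in _ < X]lnK// ltr_expR.
    by apply/idP/idP; rewrite !inE /A/= !in_itv/= e1 e2.
  by case: (t \in A).
- by move=> s /=; rewrite !in_itv/= andbT => /andP[].
- by apply: pos_measurable_oo; exact: ltW.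
Qed.

Lemma tilde_norm_dilation (a b c : R) f : 0 < a -> 0 < c ->
  nneg_measurable_on `]c * a, c * b[ f ->
  nneg_measurable_on `]a, b[ (fun s => f (c * s)) ->
  tilde_norm E `]c * a, c * b[ f = tilde_norm E `]a, b[ (fun s => f (c * s)).
Proof.
move=> a0 c0 nf nfc.
rewrite (@tilde_norm_expR (c * a) _ f) ?mulr_gt0//; first last.
- by apply: pos_measurable_oo; rewrite ltW// mulr_gt0.
- by move=> s /=; rewrite !in_itv/= andbT => /andP[].
rewrite (@tilde_norm_expR a)//; first last.
- by apply: pos_measurable_oo; rewrite ltW.
- by move=> s /=; rewrite !in_itv/= andbT => /andP[].
congr (ri_norm E _); apply/funext => t; rewrite !patchE mulrA.
congr (if _ then _ else _).
by apply/idP/idP; rewrite !inE/= !in_itv/= -mulrA !ltr_pM2l.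
Qed.

Lemma measurable_powR_posR (e : R) : measurable_fun (@posR R) (fun s => s `^ e).
Proof. by apply: measurable_funTS; exact: measurable_powR. Qed.

Lemma nneg_measurable_on_powR I (e : R) : pos_measurable I ->
  nneg_measurable_on I (fun s => (s `^ e)%:E).
Proof.
move=> [mI Ip]; apply: nneg_measurable_on_EFin; last by move=> s _; exact: powR_ge0.
by apply: measurable_funS (measurable_powR_posR e) => //; exact: measurable_posR.
Qed.

(** With [A n] the norm of [s ^ (- e)] on [(1, exp n)], invariance under
    dilation by [exp 1] yields [A (n + 1) <= A 1 + exp (- e) * A n].  So [A n] is
    bounded by a geometric series, and the Fatou property gives the limit. *)
Lemma expR_norm_fin (e : R) : 0 < e ->
  (E (fun t => (expR (- e * t))%:E) < +oo)%E.
Proof.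
move=> e0.
pose w s := ((s `^ (- e))%:E : \bar R).
pose I n := `]1 : R, expR n%:R[%classic.
have pI n : pos_measurable (I n) by exact: pos_measurable_oo.
pose A n := tilde_norm E (I n) w.
have A1fin : (A 1%N < +oo)%E.
  have e1 : 1 < expR 1 :> R by rewrite expR_gt1.
  have [m m0 Hm] := tilde_norm1 e1.
  apply: (@le_lt_trans _ _ m%:E); last exact: ltry.
  rewrite -(Hm _ ltr01); apply: le_tilde_norm => //.
  - by apply: pos_measurable_oo.
  - exact: nneg_measurable_on_powR.
  - by rewrite mulr1.
  - move=> s; rewrite /I/= in_itv/= lee_fin => /andP[s1 _].
    by rewrite -[leRHS](powRr0 s) (ler_powR (ltW s1))// oppr_le0 ltW.
pose q := expR (- e).
have q0 : 0 <= q by exact: expR_ge0.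
have q1 : q < 1 by rewrite expR_lt1 oppr_lt0.
have AS n : (A n.+1 <= A 1%N + q%:E * A n)%E.
  have -> : (q%:E * A n)%E = tilde_norm E `]expR 1 * 1, expR 1 * expR n%:R[ w.
    rewrite tilde_norm_dilation ?expR_gt0//; last 2 first.
    - by apply: nneg_measurable_on_powR; apply: pos_measurable_oo; rewrite mulr1 expR_ge0.
    - apply: nneg_measurable_onS (pI n) _ _ => //.
      apply: nneg_measurable_on_EFin => [|s _]; last exact: powR_ge0.
      apply: measurable_funTS; apply: (measurable_comp measurableT _ (@measurable_powR R _)) => //.
    rewrite -(tilde_normZ _ q0 (pI n) (nneg_measurable_on_powR _ (pI n))).
    apply: tilde_norm_ext => s; rewrite /I/= in_itv/= => /andP[s1 _].
    rewrite /w powRM ?expR_ge0//; last by rewrite (le_trans ler01)// ltW.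
    by rewrite expR_powR mulr1 EFinM.
  rewrite mulr1 -expRD.
  have -> : 1 + n%:R = n.+1%:R :> R by rewrite -natr1 addrC.
  apply: (@tilde_norm_cover _ _ _ _ _ _ (expR 1)) => //.
  - by apply: pos_measurable_oo; rewrite expR_ge0.
  - exact: nneg_measurable_on_powR.
  - exact: nneg_measurable_on_powR.
  - by apply: nneg_measurable_on_powR; apply: pos_measurable_oo; rewrite expR_ge0.
  - move=> s; rewrite /I/= !in_itv/= => /andP[s1 sn].
    by rewrite s1 sn/= andbT neq_lt => /orP[]; [left|right].
have Ale n : (A n <= (1 - q)^-1%:E * A 1%N)%E.
  have qp : 0 < 1 - q by rewrite subr_gt0.
  elim: n => [|n IHn].
    have -> : A 0%N = tilde_norm E (I 0%N) (fun s => 0%:E * w s)%E.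
      apply: tilde_norm_ext => s; rewrite /I/= in_itv/= expR0.
      by move=> /andP[/lt_trans/[apply]]; rewrite ltxx.
    rewrite (tilde_normZ _ (lexx 0) (pI 0%N) (nneg_measurable_on_powR _ (pI 0%N))).
    by rewrite mul0e mule_ge0 ?tilde_norm_ge0// lee_fin invr_ge0 ltW.
  apply: (le_trans (AS n)).
  apply: (@le_trans _ _ (A 1%N + q%:E * ((1 - q)^-1%:E * A 1%N))%E).
    by rewrite leeD2l// lee_wpmul2l.
  move: A1fin (tilde_norm_ge0 E (I 1%N) w); rewrite -/(A 1%N).
  case: (A 1%N) => [r| |]// _ _.
  rewrite -!EFinM -EFinD lee_fin le_eqVlt; apply/orP; left; apply/eqP.
  field; by rewrite gt_eqF.
have := @ri_norm_fatou _ E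
  (fun n t => (w \_ (I n)) (1 * expR t)) (fun t => (expR (- e * t))%:E).
move=> cv; apply: (@le_lt_trans _ _ ((1 - q)^-1%:E * A 1%N)%E); last first.
  have A1 : A 1%N \is a fin_num by rewrite ge0_fin_numE ?tilde_norm_ge0.
  by rewrite -(fineK A1) -EFinM ltry.
apply: cvge_le (cv _ _ _).
- apply: nearW => n; apply: le_trans (Ale n); rewrite /A (@tilde_norm_expR 1)//.
  - by move=> s; rewrite /I/= !in_itv/= andbT => /andP[].
  - exact: nneg_measurable_on_powR.
- move=> n; apply: nneg_measurable_expR => //; apply: nneg_measurable_on_restrict => //.
  exact: nneg_measurable_on_powR.
- exact: nneg_measurable_expRM.
- apply: aeW => t t0; split.
    move=> m n mn; rewrite !patchE; case: ifPn.
      rewrite inE /I/= in_itv/= => /andP[t1 tm]; rewrite ifT//.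
      by rewrite inE/= in_itv/= t1 (lt_le_trans tm)// ler_expR ler_nat.
    by move=> _; case: ifPn => // _; rewrite lee_fin powR_ge0.
  apply: cvg_near_cst; near=> n; rewrite patchE ifT.
    by rewrite /w mul1r expR_powR.
  rewrite inE /I/= in_itv/= mul1r expR_gt1 t0 ltr_expR/=.
  near: n; exact: nbhs_infty_gtr.
Unshelve. all: end_near. Qed.

End power_norms.

(** * Slowly varying weights *)

Section weights.
Context {R : realType}.
Implicit Types (E : ri_space R) (a b w : R -> R) (e u : R).

Definition almost_nondecreasing w := exists2 C : R, 0 < C &
  forall s t, 0 < s -> s <= t -> w s <= C * w t.

Definition almost_nonincreasing w := exists2 C : R, 0 < C &
  forall s t, 0 < s -> s <= t -> w t <= C * w s.

(** Slow variation with the equivalence to a monotone function replaced by the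
    inequality between values that it implies.  In this form products, inverses
    and tail norms are easily seen to inherit the property. *)
Record sv_weight b : Prop := SVWeight {
  svw_gt0 : forall t, 0 < t -> 0 < b t;
  svw_measurable : measurable_fun (@posR R) b;
  svw_up : forall e, 0 < e -> almost_nondecreasing (fun t => t `^ e * b t);
  svw_down : forall e, 0 < e -> almost_nonincreasing (fun t => t `^ (- e) * b t)
}.

Lemma slowly_varying_weight b : slowly_varying b -> sv_weight b.
Proof.
move=> [b0 mb up down]; split => // e e0.
- have [g gm [c c0 cg]] := up e e0; exists (c * c); first exact: mulr_gt0.
  move=> s t s0 st; have t0 := lt_le_trans s0 st.
  apply: (le_trans (cg s s0).1); rewrite -mulrA ler_pM2l//.
  exact: le_trans (gm _ _ s0 st) (cg t t0).2.
- have [g gm [c c0 cg]] := down e e0; exists (c * c); first exact: mulr_gt0.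
  move=> s t s0 st; have t0 := lt_le_trans s0 st.
  apply: (le_trans (cg t t0).1); rewrite -mulrA ler_pM2l//.
  exact: le_trans (gm _ _ s0 st) (cg s s0).2.
Qed.

Lemma powR_half (x e : R) : x != 0 -> x `^ e = x `^ (e / 2) * x `^ (e / 2).
Proof. by move=> x0; rewrite -powRD ?x0 ?implybT// -splitr. Qed.

Lemma sv_weightM a b : sv_weight a -> sv_weight b -> sv_weight (a \* b).
Proof.
move=> [a0 ma au ad] [b0 mb bu bd]; split=> [t t0||e e0|e e0].
- by rewrite /= mulr_gt0 ?a0 ?b0.
- exact: measurable_funM.
- have e2 : 0 < e / 2 by rewrite divr_gt0.
  have [c c0 ca] := au _ e2; have [d d0 db] := bu _ e2.
  exists (c * d); first exact: mulr_gt0.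
  move=> s t s0 st /=; have t0 := lt_le_trans s0 st.
  rewrite !(powR_half e) ?gt_eqF//
    [X in X <= _]mulrACA [X in _ <= _ * X]mulrACA [X in _ <= X]mulrACA.
  have := ltW (a0 _ s0); have := ltW (b0 _ s0) => bs as_.
  by apply: ler_pM; rewrite ?mulr_ge0 ?powR_ge0 ?ca ?db.
- have e2 : 0 < e / 2 by rewrite divr_gt0.
  have [c c0 ca] := ad _ e2; have [d d0 db] := bd _ e2.
  exists (c * d); first exact: mulr_gt0.
  move=> s t s0 st /=; have t0 := lt_le_trans s0 st.
  rewrite !(powR_half (- e)) ?gt_eqF// mulNr
    [X in X <= _]mulrACA [X in _ <= _ * X]mulrACA [X in _ <= X]mulrACA.
  have := ltW (a0 _ t0); have := ltW (b0 _ t0) => bs as_.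
  by apply: ler_pM; rewrite ?mulr_ge0 ?powR_ge0 ?ca ?db.
Qed.

Lemma sv_weightV b : sv_weight b -> sv_weight (fun t => (b t)^-1).
Proof.
move=> [b0 mb bu bd]; split=> [t t0||e e0|e e0].
- by rewrite invr_gt0 b0.
- apply: (measurable_comp (@measurable_posR R) _ (@measurable_inv_posR R)) => //.
  move=> _ [t + <-]; rewrite /posR/= !in_itv/= !andbT; exact: b0.
- have [c c0 cb] := bd _ e0; exists c => // s t s0 st.
  have t0 := lt_le_trans s0 st; have := cb _ _ s0 st; rewrite !powRN.
  have ps := powR_gt0 e s0; have pt := powR_gt0 e t0.
  have bs := b0 _ s0; have bt := b0 _ t0.
  move=> /(ler_wpM2r (_ : 0 <= s `^ e * t `^ e / (b s * b t))).
  rewrite divr_ge0 ?mulr_ge0 ?(ltW ps) ?(ltW pt) ?(ltW bs) ?(ltW bt)// => /(_ isT).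
  by congr (_ <= _); field; rewrite !gt_eqF.
- have [c c0 cb] := bu _ e0; exists c => // s t s0 st.
  have t0 := lt_le_trans s0 st; have := cb _ _ s0 st; rewrite !powRN.
  have ps := powR_gt0 e s0; have pt := powR_gt0 e t0.
  have bs := b0 _ s0; have bt := b0 _ t0.
  move=> /(ler_wpM2r (_ : 0 <= (s `^ e * t `^ e * (b s * b t))^-1)).
  rewrite invr_ge0 !mulr_ge0 ?(ltW ps) ?(ltW pt) ?(ltW bs) ?(ltW bt)// => /(_ isT).
  by congr (_ <= _); field; rewrite !gt_eqF.
Qed.

Lemma sv_weight_doubling b : sv_weight b -> exists2 C, 0 < C &
  forall s t, 0 < s -> s <= t -> t <= 2 * s -> b s <= C * b t /\ b t <= C * b s.
Proof.
move=> [b0 mb bu bd]; have [c c0 cb] := bu 1 ltr01; have [d d0 db] := bd 1 ltr01.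
exists (2 * (c + d)); first by rewrite mulr_gt0 ?addr_gt0.
move=> s t s0 st ts; have t0 := lt_le_trans s0 st.
have := cb _ _ s0 st; have := db _ _ s0 st.
rewrite !(powRr1 (ltW t0)) !(powRr1 (ltW s0)) (powR_inv1 (ltW t0)) (powR_inv1 (ltW s0)).
have bs := b0 _ s0; have bt := b0 _ t0.
move=> h1 h2; split.
  rewrite -(ler_pM2l s0); apply: (le_trans h2).
  have -> : s * (2 * (c + d) * b t) = c * ((2 * s) * b t) + 2 * d * s * b t by ring.
  apply: ler_wpDr; first by rewrite ltW// !mulr_gt0.
  by rewrite ler_pM2l// ler_pM2r.
have h3 : b t <= d * (s^-1 * b s) * t by rewrite -ler_pdivrMr// mulrC.
apply: (le_trans h3).
have -> : 2 * (c + d) * b s = d * (s^-1 * b s) * (2 * s) + 2 * c * b s.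
  by field; rewrite gt_eqF.
apply: ler_wpDr; first by rewrite ltW// !mulr_gt0.
by rewrite ler_pM2l// !mulr_gt0// invr_gt0.
Qed.

Lemma le_tilde_normZ E (c : R) (I : set R) (f g : R -> \bar R) : 0 <= c ->
  pos_measurable I -> nneg_measurable_on I f -> nneg_measurable_on I g ->
  (forall s, I s -> (f s <= c%:E * g s)%E) ->
  (tilde_norm E I f <= c%:E * tilde_norm E I g)%E.
Proof.
move=> c0 pI nf ng fg; rewrite -(tilde_normZ _ c0 pI ng).
by apply: (le_tilde_norm _ pI pI) => //; exact: nneg_measurable_onZ.
Qed.

Lemma nneg_measurable_on_weight (I : set R) w : pos_measurable I ->
  measurable_fun (@posR R) w -> (forall t, 0 < t -> 0 <= w t) ->
  nneg_measurable_on I (EFin \o w).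
Proof.
move=> [mI Ip] mw w0; apply: nneg_measurable_on_EFin.
  by apply: measurable_funS mw => //; exact: measurable_posR.
by move=> s /Ip; rewrite /posR/= in_itv/= andbT; exact: w0.
Qed.

Lemma measurable_powR_weight e b : measurable_fun (@posR R) b ->
  measurable_fun (@posR R) (fun t => t `^ e * b t).
Proof. by move=> mb; apply: measurable_funM => //; exact: measurable_powR_posR. Qed.

(** In the logarithmic variable based at [u] the power becomes
    [u ^ (- e) * exp (- e t)]. *)
Lemma tilde_norm_tail_powR E e : 0 < e -> exists2 C, 0 < C & forall u, 0 < u ->
  (tilde_norm E `]u, +oo[ (fun s => (s `^ (- e))%:E) <= (C * u `^ (- e))%:E)%E.
Proof.
move=> e0.
have nh := nneg_measurable_expRM (- e).
have hf := expR_norm_fin E e0.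
have h0 := ri_norm_ge0 E nh.
set N := E _ in hf h0.
have Nf : N \is a fin_num by rewrite ge0_fin_numE.
exists (fine N + 1); first by rewrite ltr_wpDl ?fine_ge0.
move=> u u0.
have pI := pos_measurable_oy (ltW u0).
have nw := @nneg_measurable_on_powR _ _ (- e) pI.
rewrite (tilde_norm_expR _ u0 (fun _ => id) pI nw).
have nuh := nneg_measurableZ (powR_ge0 u (- e)) nh.
have -> : E (fun t => ((fun s => (s `^ (- e))%:E) \_ `]u, +oo[) (u * expR t)) =
          E (fun t => (u `^ (- e))%:E * (expR (- e * t))%:E)%E.
  apply: ri_norm_eq => //.
    apply: nneg_measurable_expR => //; exact: nneg_measurable_on_restrict.
  move=> t t0; rewrite patchE ifT.
    by rewrite powRM ?expR_ge0 ?ltW// expR_powR EFinM.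
  by rewrite inE/= in_itv/= andbT ltr_pMr// expR_gt1.
rewrite ri_normZ ?powR_ge0// -/N -(fineK Nf) -EFinM lee_fin.
by rewrite mulrC ler_wpM2r ?powR_ge0// lerDl.
Qed.

(** The part of [(0, u)] where [s ^ e] exceeds [u ^ e * exp (- e t)] is
    [(u * exp (- t), u)], of measure [t]; so the rearrangement is bounded by
    [u ^ e * exp (- e t)]. *)
Lemma tilde_norm_head_powR E e : 0 < e -> exists2 C, 0 < C & forall u, 0 < u ->
  (tilde_norm E `]0%R, u[ (fun s => (s `^ e)%:E) <= (C * u `^ e)%:E)%E.
Proof.
move=> e0.
have nh := nneg_measurable_expRM (- e).
have hf := expR_norm_fin E e0.
have h0 := ri_norm_ge0 E nh.
set N := E _ in hf h0.
have Nf : N \is a fin_num by rewrite ge0_fin_numE.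
exists (fine N + 1); first by rewrite ltr_wpDl ?fine_ge0.
move=> u u0.
have pI := pos_measurable_oo u (lexx 0).
have nw := nneg_measurable_on_restrict pI (@nneg_measurable_on_powR _ _ e pI).
have nuh := nneg_measurableZ (powR_ge0 u e) nh.
apply: (@le_trans _ _ (E (fun t => (u `^ e)%:E * (expR (- e * t))%:E)%E)); last first.
  rewrite ri_normZ ?powR_ge0// -/N -(fineK Nf) -EFinM lee_fin.
  by rewrite mulrC ler_wpM2r ?powR_ge0// lerDl.
apply: ri_norm_le => //; first exact: nneg_measurable_rearrangement.
apply: aeW => t t0; apply: ereal_inf_lbound; split.
  by rewrite mule_ge0 ?lee_fin ?powR_ge0 ?expR_ge0.
rewrite dtt_level_abs//.
pose J := `]u * expR (- t), u[%classic.
apply: (@le_trans _ _ (dtt J)).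
  apply: le_dtt; [exact: measurable_level_set|exact: measurable_itv|].
  move=> s [s0]; rewrite patchE; case: ifPn => [|_].
    rewrite inE/= /J/= !in_itv/= => /andP[_ su]; rewrite -EFinM lte_fin => h.
    rewrite su andbT ltNge; apply: contraTN h => h; rewrite -leNgt.
    have -> : u `^ e * expR (- e * t) = (u * expR (- t)) `^ e.
      by rewrite powRM ?expR_ge0 ?(ltW u0)// expR_powR mulrN mulNr.
    rewrite ge0_ler_powR ?(ltW e0)// nnegrE ?(ltW s0)//.
    by rewrite mulr_ge0 ?expR_ge0 ?(ltW u0).
  by rewrite ltNge mule_ge0 ?lee_fin ?powR_ge0 ?expR_ge0.
rewrite (dtt_lebesgue u0)//; last exact: measurable_itv.
rewrite (_ : [set x | _] = `]- t, 0[%classic).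
  by rewrite lebesgue_measure_itv/= lte_fin oppr_lt0 t0 -EFinB lee_fin sub0r opprK.
apply/seteqP; split=> x /=; rewrite /J/= !in_itv/= ltr_pM2l// ltr_expR.
  by move=> /andP[->/=]; rewrite gtr_pMr// expR_lt1.
by move=> /andP[->/=]; rewrite gtr_pMr// expR_lt1.
Qed.

End weights.

(** * Norms of slowly varying weights *)

Section weight_norms.
Context {R : realType}.
Implicit Types (E F : ri_space R) (a b w k : R -> R) (u : R) (I : set R).

Lemma posRP I s : pos_measurable I -> I s -> 0 < s.
Proof. by move=> [_ Ip] /Ip; rewrite /posR/= in_itv/= andbT. Qed.

Lemma nneg_measurable_on_powR_weight I (e : R) b : pos_measurable I ->
  sv_weight b -> nneg_measurable_on I (fun s => (s `^ e * b s)%:E).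
Proof.
move=> pI [b0 mb _ _]; apply: (nneg_measurable_on_weight pI).
  exact: measurable_powR_weight.
by move=> t t0; rewrite mulr_ge0 ?powR_ge0// ltW// b0.
Qed.

Lemma nneg_measurable_on_sv I b : pos_measurable I ->
  sv_weight b -> nneg_measurable_on I (EFin \o b).
Proof.
by move=> pI [b0 mb _ _]; apply: nneg_measurable_on_weight => // t /b0/ltW.
Qed.

(** Half of the exponent makes [s ^ (- theta / 2) * a s] almost decreasing, so
    that this factor may be replaced by its value at [u]; the other half leaves
    a power with finite norm. *)
Lemma tilde_norm_tail E a (theta : R) : sv_weight a -> 0 < theta ->
  exists2 C, 0 < C & forall u, 0 < u ->
  (tilde_norm E `]u, +oo[ (fun s => (s `^ (- theta) * a s)%:E) <=
   (C * (u `^ (- theta) * a u))%:E)%E.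
Proof.
move=> sa theta0; have th2 : 0 < theta / 2 by rewrite divr_gt0.
have [c c0 ca] := svw_down sa th2.
have [d d0 hd] := tilde_norm_tail_powR E th2.
exists (c * d); first exact: mulr_gt0.
move=> u u0; have pI := pos_measurable_oy (ltW u0).
have au := svw_gt0 sa u0.
have pu := powR_gt0 (- (theta / 2)) u0.
have c1 : 0 <= c * (u `^ (- (theta / 2)) * a u) by rewrite ltW// !mulr_gt0.
apply: (@le_trans _ _ ((c * (u `^ (- (theta / 2)) * a u))%:E *
    tilde_norm E `]u, +oo[ (fun s => (s `^ (- (theta / 2)))%:E))%E).
  apply: (le_tilde_normZ E c1 pI).
  - exact: nneg_measurable_on_powR_weight.
  - exact: nneg_measurable_on_powR.
  - move=> s /=; rewrite in_itv/= andbT => us; rewrite -EFinM lee_fin.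
    have s0 : 0 < s := lt_trans u0 us.
    rewrite (powR_half (- theta)) ?gt_eqF// mulNr mulrC mulrCA mulrC.
    by rewrite ler_wpM2r ?powR_ge0// mulrC; exact: ca _ _ u0 (ltW us).
apply: (@le_trans _ _ ((c * (u `^ (- (theta / 2)) * a u))%:E *
   (d * u `^ (- (theta / 2)))%:E)%E).
  by apply: lee_wpmul2l; [rewrite lee_fin|exact: hd].
rewrite -EFinM lee_fin le_eqVlt; apply/orP; left; apply/eqP.
by rewrite (powR_half (- theta)) ?gt_eqF// mulNr; ring.
Qed.

Lemma tilde_norm_head E a (theta : R) : sv_weight a -> 0 < theta ->
  exists2 C, 0 < C & forall u, 0 < u ->
  (tilde_norm E `]0%R, u[ (fun s => (s `^ theta * a s)%:E) <=
   (C * (u `^ theta * a u))%:E)%E.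
Proof.
move=> sa theta0; have th2 : 0 < theta / 2 by rewrite divr_gt0.
have [c c0 ca] := svw_up sa th2.
have [d d0 hd] := tilde_norm_head_powR E th2.
exists (c * d); first exact: mulr_gt0.
move=> u u0; have pI := pos_measurable_oo u (lexx 0).
have au := svw_gt0 sa u0.
have pu := powR_gt0 (theta / 2) u0.
have c1 : 0 <= c * (u `^ (theta / 2) * a u) by rewrite ltW// !mulr_gt0.
apply: (@le_trans _ _ ((c * (u `^ (theta / 2) * a u))%:E *
    tilde_norm E `]0%R, u[ (fun s => (s `^ (theta / 2))%:E))%E).
  apply: (le_tilde_normZ E c1 pI).
  - exact: nneg_measurable_on_powR_weight.
  - exact: nneg_measurable_on_powR.
  - move=> s /=; rewrite in_itv/= => /andP[s0 su]; rewrite -EFinM lee_fin.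
    rewrite (powR_half theta) ?gt_eqF// mulrC mulrCA mulrC.
    by rewrite ler_wpM2r ?powR_ge0// mulrC; exact: ca _ _ s0 (ltW su).
apply: (@le_trans _ _ ((c * (u `^ (theta / 2) * a u))%:E *
   (d * u `^ (theta / 2))%:E)%E).
  by apply: lee_wpmul2l; [rewrite lee_fin|exact: hd].
rewrite -EFinM lee_fin le_eqVlt; apply/orP; left; apply/eqP.
by rewrite (powR_half theta) ?gt_eqF//; ring.
Qed.

(** A dyadic interval has a fixed positive measure with respect to [dt / t],
    and a slowly varying function is nearly constant on it. *)
Lemma sv_le_tail_norm E b : sv_weight b -> exists2 C, 0 < C & forall u, 0 < u ->
  ((b u)%:E <= C%:E * tilde_norm E `]u, +oo[ (EFin \o b))%E.
Proof.
move=> sb; have [c c0 hc] := sv_weight_doubling sb.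
have [m m0 hm] := tilde_norm1 E (ltr1n _ 2 : 1 < 2 :> R).
exists (c / m); first exact: divr_gt0.
move=> u u0; have bu := svw_gt0 sb u0.
have pJ := pos_measurable_oy (ltW u0).
have pI := pos_measurable_oo (2 * u) (ltW u0).
have IJ : `]u, 2 * u[ `<=` `]u, +oo[.
  by move=> s /=; rewrite !in_itv/= => /andP[->].
have nI := nneg_measurable_on_sv pI sb.
have n1 := nneg_measurable_on_cst `]u, 2 * u[ (ler01 : 0 <= 1 :> R).
have key : ((c^-1 * b u)%:E * m%:E <= tilde_norm E `]u, +oo[ (EFin \o b))%E.
  have q0 : 0 <= c^-1 * b u by rewrite ltW// mulr_gt0// invr_gt0.
  rewrite -(hm u u0) -(tilde_normZ _ q0 pI n1); apply: (le_tilde_norm _ pI pJ) => //.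
  - exact: nneg_measurable_onZ.
  - exact: nneg_measurable_on_sv.
  - move=> s; rewrite /= in_itv/= => /andP[us su]; rewrite -EFinM lee_fin mulr1.
    by rewrite ler_pdivrMl//; exact: (hc _ _ u0 (ltW us) (ltW su)).1.
have : ((c / m)%:E * ((c^-1 * b u)%:E * m%:E) <=
    (c / m)%:E * tilde_norm E `]u, +oo[ (EFin \o b))%E.
  by apply: lee_wpmul2l => //; rewrite lee_fin ltW// divr_gt0.
apply: le_trans; rewrite -!EFinM lee_fin le_eqVlt; apply/orP; left; apply/eqP.
by field; rewrite !gt_eqF.
Qed.

(** The properties of [t |-> K(t, f)] that enter the estimates. *)
Record quasi_concave k : Prop := QuasiConcave {
  qc_ge0 : forall t, 0 < t -> 0 <= k t;
  qc_le : forall s t, 0 < s -> s <= t -> k s <= k t;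
  qc_div : forall s t, 0 < s -> s <= t -> s * k t <= t * k s
}.

Lemma measurable_quasi_concave k : quasi_concave k -> measurable_fun (@posR R) k.
Proof.
move=> [_ kle _]; apply/measurable_EFinP; apply: monotone_measurable_posR.
by left => s t s0 st; rewrite lee_fin kle.
Qed.

Definition weighted (theta : R) a k s : \bar R := (s `^ (- theta) * a s * k s)%:E.

Lemma nneg_measurable_on_weighted I theta a k : pos_measurable I ->
  sv_weight a -> quasi_concave k -> nneg_measurable_on I (weighted theta a k).
Proof.
move=> pI [a0 ma _ _] qk; apply: (nneg_measurable_on_weight pI).
  apply: measurable_funM; last exact: measurable_quasi_concave.
  exact: measurable_powR_weight.
by move=> t t0; rewrite !mulr_ge0 ?powR_ge0 ?(ltW (a0 _ t0)) ?(qc_ge0 qk).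
Qed.

(** On [(u / 2, u)] the power, the slowly varying factor and [k] are all bounded
    below by a constant times their values at [u]. *)
Lemma weighted_le_head_norm F a theta : sv_weight a -> 0 < theta ->
  exists2 C, 0 < C & forall k u, quasi_concave k -> 0 < u ->
  (weighted theta a k u <= C%:E * tilde_norm F `]0%R, u[ (weighted theta a k))%E.
Proof.
move=> sa th0; have [c c0 hc] := sv_weight_doubling sa.
have [m m0 hm] := tilde_norm1 F (ltr1n _ 2 : 1 < 2 :> R).
exists (2 * c / m); first by rewrite divr_gt0 ?mulr_gt0.
move=> k u qk u0; have au := svw_gt0 sa u0.
have h0 : 0 < u / 2 by rewrite divr_gt0.
have hu : 2 * (u / 2) = u by field.
have pJ := pos_measurable_oo u (lexx 0).
have pI := pos_measurable_oo (2 * (u / 2)) (ltW h0).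
have IJ : `]u / 2, 2 * (u / 2)[ `<=` `]0, u[.
  by move=> s /=; rewrite hu !in_itv/= => /andP[/(lt_trans h0) -> ->].
have n1 := nneg_measurable_on_cst `]u / 2, 2 * (u / 2)[ (ler01 : 0 <= 1 :> R).
pose q := (2 * c)^-1 * (u `^ (- theta) * a u * k u).
have q0 : 0 <= q.
  by rewrite !mulr_ge0 ?invr_ge0 ?powR_ge0 ?(ltW au) ?(qc_ge0 qk)// ltW// mulr_gt0.
have key : (q%:E * m%:E <= tilde_norm F `]0%R, u[ (weighted theta a k))%E.
  rewrite -(hm (u / 2) h0) -(tilde_normZ _ q0 pI n1).
  apply: (le_tilde_norm _ pI pJ) => //.
  - exact: nneg_measurable_onZ.
  - exact: nneg_measurable_on_weighted.
  - move=> s; rewrite hu /= in_itv/= => /andP[us su]; rewrite -EFinM lee_fin mulr1.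
    have s0 : 0 < s by exact: lt_trans us.
    have u2s : u <= 2 * s by rewrite mulrC -ler_pdivrMr// ltW.
    have as0 := svw_gt0 sa s0.
    have e1 : u `^ (- theta) <= s `^ (- theta).
      rewrite !powRN lef_pV2 ?posrE ?powR_gt0//.
      rewrite ge0_ler_powR ?nnegrE ?(ltW th0) ?(ltW s0) ?(ltW u0)//.
      exact: ltW.
    have e2 : c^-1 * a u <= a s by rewrite ler_pdivrMl//; exact: (hc _ _ s0 (ltW su) u2s).2.
    have e3 : 2^-1 * k u <= k s.
      rewrite -(ler_pM2l u0); apply: le_trans (_ : s * k u <= _).
        by rewrite mulrA ler_wpM2r ?(qc_ge0 qk)// ltW.
      exact: (qc_div qk s0 (ltW su)).
    have -> : q = u `^ (- theta) * (c^-1 * a u) * (2^-1 * k u).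
      by rewrite /q invfM; ring.
    have ci : 0 <= c^-1 by rewrite invr_ge0 ltW.
    have ku : 0 <= 2^-1 * k u by rewrite mulr_ge0 ?invr_ge0 ?(qc_ge0 qk).
    have au' : 0 <= c^-1 * a u by rewrite mulr_ge0 ?(ltW au).
    apply: ler_pM => //; first by rewrite mulr_ge0 ?powR_ge0.
    by apply: ler_pM => //; exact: powR_ge0.
have : ((2 * c / m)%:E * (q%:E * m%:E) <=
    (2 * c / m)%:E * tilde_norm F `]0%R, u[ (weighted theta a k))%E.
  by apply: lee_wpmul2l => //; rewrite lee_fin ltW// divr_gt0 ?mulr_gt0.
apply: le_trans; rewrite -!EFinM lee_fin le_eqVlt; apply/orP; left; apply/eqP.
by rewrite /q; field; rewrite !gt_eqF.
Qed.

Section tail_weight.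
Context (E : ri_space R) (b : R -> R) (sb : sv_weight b)
  (bfin : (tilde_norm E `]1%R, +oo[ (EFin \o b) < +oo)%E).

Lemma tail_norm_fin_num u : 0 < u ->
  tilde_norm E `]u, +oo[ (EFin \o b) \is a fin_num.
Proof.
move=> u0; rewrite (ge0_fin_numE (tilde_norm_ge0 _ _ _)).
have pu := pos_measurable_oy (ltW u0).
have p1 := pos_measurable_oy (ler01 : 0 <= 1 :> R).
have [u1|u1] := leP 1 u.
  apply: le_lt_trans bfin; apply: (le_tilde_norm _ pu p1) => //;
    try exact: nneg_measurable_on_sv.
  by move=> s /=; rewrite !in_itv/= !andbT; exact: le_lt_trans.
have [c c0 hc] := svw_down sb ltr01.
have [d d0 hd] := tilde_norm_head_powR E (ltr01 : 0 < 1 :> R).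
have p2 := pos_measurable_oo 1 (ltW u0).
have p3 := pos_measurable_oo 1 (lexx (0 : R)).
apply: (@le_lt_trans _ _ (tilde_norm E `]u, 1%R[ (EFin \o b) +
    tilde_norm E `]1%R, +oo[ (EFin \o b))%E).
  apply: (tilde_norm_cover E (u := 1) pu p2 p1); try exact: nneg_measurable_on_sv.
  move=> s /=; rewrite !in_itv/= !andbT => ->; rewrite neq_lt => /orP[]; by [left|right].
apply: (lte_add_pinfty _ bfin).
have k0 : 0 <= c * (u^-1 * b u).
  by rewrite ltW// !mulr_gt0 ?invr_gt0 ?(svw_gt0 sb).
apply: (@le_lt_trans _ _ ((c * (u^-1 * b u))%:E *
    tilde_norm E `]0%R, 1%R[ (fun s => (s `^ 1)%:E))%E).
  rewrite -(tilde_normZ _ k0 p3 (nneg_measurable_on_powR _ p3)).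
  apply: (le_tilde_norm _ p2 p3).
  - exact: nneg_measurable_on_sv.
  - by apply: nneg_measurable_onZ => //; exact: nneg_measurable_on_powR.
  - by move=> s /=; rewrite !in_itv/= => /andP[/(lt_trans u0)-> ->].
  - move=> s /=; rewrite !in_itv/= => /andP[us s1].
    have s0 := lt_trans u0 us.
    rewrite -EFinM lee_fin powRr1 ?(ltW s0)// -ler_pdivrMr// mulrC.
    by have := hc _ _ u0 (ltW us); rewrite !powR_inv1 ?(ltW u0) ?(ltW s0).
apply: (@le_lt_trans _ _ ((c * (u^-1 * b u))%:E * (d * 1 `^ 1)%:E)%E).
  by apply: lee_wpmul2l; [rewrite lee_fin|exact: hd].
by rewrite -EFinM ltry.
Qed.

Definition tail_norm u := fine (tilde_norm E `]u, +oo[ (EFin \o b)).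

Lemma tail_normE u : 0 < u ->
  (tail_norm u)%:E = tilde_norm E `]u, +oo[ (EFin \o b).
Proof. by move=> u0; rewrite /tail_norm fineK// tail_norm_fin_num. Qed.

Lemma sv_le_tail : exists2 C, 0 < C & forall u, 0 < u -> b u <= C * tail_norm u.
Proof.
have [C C0 hC] := sv_le_tail_norm E sb; exists C => // u u0.
by rewrite -lee_fin EFinM (tail_normE u0); exact: hC.
Qed.

Lemma tail_norm_gt0 u : 0 < u -> 0 < tail_norm u.
Proof.
move=> u0; have [C C0 hC] := sv_le_tail.
by rewrite -(pmulr_rgt0 _ C0); apply: lt_le_trans (hC _ u0); exact: (svw_gt0 sb).
Qed.

Lemma tail_norm_anti s t : 0 < s -> s <= t -> tail_norm t <= tail_norm s.
Proof.
move=> s0 st; have t0 := lt_le_trans s0 st.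
rewrite -lee_fin [X in (X <= _)%E](tail_normE t0) [X in (_ <= X)%E](tail_normE s0).
apply: (le_tilde_norm _ (pos_measurable_oy (ltW t0)) (pos_measurable_oy (ltW s0))) => //;
  try exact: nneg_measurable_on_sv (pos_measurable_oy _) _.
- by apply: nneg_measurable_on_sv => //; apply: pos_measurable_oy; exact: ltW.
- by apply: nneg_measurable_on_sv => //; apply: pos_measurable_oy; exact: ltW.
- by move=> x /=; rewrite !in_itv/= !andbT; exact: le_lt_trans.
Qed.

(** The tail norm decreases, so what has to be shown is that [t ^ e] times it is
    almost increasing, that is, that the norm over [(s, t)] is controlled: there
    [b x] is at most a multiple of [x ^ (- e) * t ^ e * b t], and [b t] is at
    most a multiple of the norm over [(t, +oo)]. *)
Lemma sv_tail_norm : sv_weight tail_norm.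
Proof.
have anti := tail_norm_anti; split => [|||e e0].
- exact: tail_norm_gt0.
- apply/measurable_EFinP; apply: monotone_measurable_posR.
  by right => s t s0 st; rewrite lee_fin anti.
- move=> e e0; have [c c0 hc] := svw_up sb e0.
  have [d d0 hd] := tilde_norm_tail_powR E e0.
  have [m m0 hm] := sv_le_tail.
  exists (c * d * m + 1); first by rewrite addr_gt0 ?mulr_gt0.
  move=> s t s0 st; have t0 := lt_le_trans s0 st.
  have ps := pos_measurable_oy (ltW s0).
  have pt := pos_measurable_oy (ltW t0).
  have pst := pos_measurable_oo t (ltW s0).
  have bt := svw_gt0 sb t0.
  have k0 : 0 <= c * (t `^ e * b t) by rewrite ltW// !mulr_gt0 ?powR_gt0.
  have : (tilde_norm E `]s, +oo[ (EFin \o b) <=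
      tilde_norm E `]s, t[ (EFin \o b) + tilde_norm E `]t, +oo[ (EFin \o b))%E.
    apply: (tilde_norm_cover E (u := t) ps pst pt); try exact: nneg_measurable_on_sv.
    by move=> x /=; rewrite !in_itv/= !andbT => ->; rewrite neq_lt => /orP[]; [left|right].
  have : (tilde_norm E `]s, t[ (EFin \o b) <= (c * (t `^ e * b t))%:E *
      tilde_norm E `]s, +oo[ (fun x => (x `^ (- e))%:E))%E.
    rewrite -(tilde_normZ _ k0 ps (nneg_measurable_on_powR _ ps)).
    apply: (le_tilde_norm _ pst ps).
    - exact: nneg_measurable_on_sv.
    - by apply: nneg_measurable_onZ => //; exact: nneg_measurable_on_powR.
    - by move=> x /=; rewrite !in_itv/= andbT => /andP[].
    - move=> x /=; rewrite !in_itv/= => /andP[sx xt].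
      have x0 := lt_trans s0 sx.
      rewrite -EFinM lee_fin powRN ler_pdivlMr ?powR_gt0// mulrC.
      exact: hc _ _ x0 (ltW xt).
  have k0' : (0%:E <= (c * (t `^ e * b t))%:E)%E by rewrite lee_fin.
  move=> h1 h2; have h3 := le_trans h1 (lee_wpmul2l k0' (hd _ s0)).
  have := le_trans h2 (leeD2r _ h3).
  rewrite -(tail_normE s0) -(tail_normE t0) -EFinM -EFinD lee_fin => h4.
  have pse := powR_gt0 e s0.
  have := ler_wpM2l (ltW pse) h4.
  move=> /le_trans; apply.
  rewrite mulrDr [X in _ <= X]mulrDl mul1r; apply: lerD; last first.
    rewrite ler_wpM2r ?(ltW (tail_norm_gt0 t0))//.
    by rewrite ge0_ler_powR ?nnegrE ?(ltW e0) ?(ltW s0) ?(ltW t0).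
  have -> : s `^ e * (c * (t `^ e * b t) * (d * s `^ (- e))) =
      c * d * (t `^ e * b t).
    by rewrite powRN; field; rewrite gt_eqF.
  have -> : c * d * m * (t `^ e * tail_norm t) =
      c * d * (t `^ e * (m * tail_norm t)) by ring.
  by rewrite !ler_pM2l ?mulr_gt0 ?powR_gt0// hm.
- exists 1; first exact: ltr01.
  move=> s t s0 st; have t0 := lt_le_trans s0 st.
  rewrite mul1r ler_pM ?powR_ge0 ?anti// ?(ltW (tail_norm_gt0 t0))//.
  rewrite !powRN lef_pV2 ?posrE ?powR_gt0//.
  by rewrite ge0_ler_powR ?nnegrE ?(ltW e0) ?(ltW s0) ?(ltW t0).
Qed.

End tail_weight.
End weight_norms.

(** * Nested norms *)

Section combinations.
Context {R : realType}.
Implicit Types (E F : ri_space R) (a b k : R -> R) (f g h : R -> \bar R)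
  (I J : set R) (c d u : R).

Lemma tilde_norm_lin2 E I f g h c d : pos_measurable I -> 0 <= c -> 0 <= d ->
  nneg_measurable_on I f -> nneg_measurable_on I g -> nneg_measurable_on I h ->
  (forall s, I s -> (f s <= c%:E * g s + d%:E * h s)%E) ->
  (tilde_norm E I f <= c%:E * tilde_norm E I g + d%:E * tilde_norm E I h)%E.
Proof.
move=> pI c0 d0 nf ng nh fgh.
have cg : nneg_measurable_on I (fun s => c%:E * g s)%E by exact: nneg_measurable_onZ.
have dh : nneg_measurable_on I (fun s => d%:E * h s)%E by exact: nneg_measurable_onZ.
rewrite -(tilde_normZ _ c0 pI ng) -(tilde_normZ _ d0 pI nh).
apply: le_trans (tilde_normD _ pI cg dh).
apply: (le_tilde_norm _ pI pI) => //; split.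
  by case: cg dh => mg _ [mh _]; exact: emeasurable_funD.
by move=> s Is; rewrite adde_ge0 ?cg.2 ?dh.2.
Qed.

Lemma nneg_measurable_on_outer I b (phi : R -> \bar R) : pos_measurable I ->
  sv_weight b -> (forall t, (0 <= phi t)%E) ->
  (forall s t, 0 < s -> s <= t -> (phi s <= phi t)%E) ->
  nneg_measurable_on I (fun t => (b t)%:E * phi t)%E.
Proof.
move=> [mI Ip] [b0 mb _ _] phi0 phile; split.
  apply: (measurable_funS (@measurable_posR R)) => //.
  apply: emeasurable_funM; first exact/measurable_EFinP.
  by apply: monotone_measurable_posR; left.
by move=> s /Ip; rewrite /posR/= in_itv/= andbT => s0; rewrite mule_ge0 ?lee_fin ?(ltW (b0 _ s0)).
Qed.

Lemma inner_norm_mono F v f s t : 0 <= v -> nneg_measurable_on (@posR R) f ->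
  s <= t -> (tilde_norm F `]v, s[ f <= tilde_norm F `]v, t[ f)%E.
Proof.
move=> v0 nf st.
have ps := pos_measurable_oo s v0; have pt := pos_measurable_oo t v0.
have pp := @pos_measurable_posR R.
apply: (le_tilde_norm _ ps pt) => //.
- exact: (nneg_measurable_onS pp ps.2 nf).
- exact: (nneg_measurable_onS pp pt.2 nf).
- by move=> x /=; rewrite !in_itv/= => /andP[-> /lt_le_trans->].
Qed.

End combinations.

Section one_space.
Context {R : realType} (E F : ri_space R) (a b : R -> R) (theta : R).
Context (sa : sv_weight a) (sb : sv_weight b) (theta0 : 0 < theta)
  (bfin : (tilde_norm E `]1%R, +oo[ (EFin \o b) < +oo)%E).
Implicit Types (k : R -> R) (u s t : R).

Local Notation B := (tail_norm E b).

Definition head_inner k t := tilde_norm F `]0%R, t[ (weighted theta a k).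

Definition outer_norm I k := tilde_norm E I (fun t => (b t)%:E * head_inner k t)%E.

Lemma nneg_measurable_on_head I k : pos_measurable I -> quasi_concave k ->
  nneg_measurable_on I (fun t => (b t)%:E * head_inner k t)%E.
Proof.
move=> pI qk; apply: (nneg_measurable_on_outer pI sb) => [t|s t _ st].
  exact: tilde_norm_ge0.
apply: (inner_norm_mono F (lexx 0) _ st).
by apply: nneg_measurable_on_weighted => //; exact: pos_measurable_posR.
Qed.

(** The inner norm is non-decreasing, so over [(u, +oo)] it may be replaced by
    its value at [u]. *)
Lemma tail_head_le k u : quasi_concave k -> 0 < u ->
  ((B u)%:E * head_inner k u <= outer_norm (@posR R) k)%E.
Proof.
move=> qk u0; have pu := pos_measurable_oy (ltW u0).
have pp := @pos_measurable_posR R.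
have nb := nneg_measurable_on_sv pu sb.
have Ngt0 : (0 < tilde_norm E `]u, +oo[ (EFin \o b))%E.
  by rewrite -(tail_normE sb bfin u0) lte_fin (tail_norm_gt0 sb bfin u0).
have h0 : (0 <= head_inner k u)%E by exact: tilde_norm_ge0.
rewrite muleC (tail_normE sb bfin u0) -(tilde_normZe h0 pu nb Ngt0).
apply: (le_tilde_norm _ pu pp).
- exact: nneg_measurable_onZ.
- exact: nneg_measurable_on_head.
- exact: pu.2.
- move=> t ut; have t0 := posRP pu ut; rewrite /= in_itv/= andbT in ut.
  rewrite muleC; apply: lee_wpmul2l; first by rewrite lee_fin ltW ?(svw_gt0 sb).
  apply: inner_norm_mono (ltW ut) => //.
  by apply: nneg_measurable_on_weighted.
Qed.

(** Membership in the space bounds [k] pointwise: by [weighted_le_head_norm] the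
    inner norm at [s] dominates the weighted value of [k] at [s], and the inner
    norm persists on [(s, +oo)]. *)
Lemma pointwise_le_outer_norm : exists2 C, 0 < C & forall k s,
  quasi_concave k -> 0 < s ->
  ((B s)%:E * weighted theta a k s <= C%:E * outer_norm (@posR R) k)%E.
Proof.
have [C C0 hC] := weighted_le_head_norm F sa theta0.
exists C => // k s qk s0; have Bs := tail_norm_gt0 sb bfin s0.
apply: (@le_trans _ _ ((B s)%:E * (C%:E * head_inner k s))%E).
  by apply: lee_wpmul2l; [rewrite lee_fin ltW|exact: hC].
rewrite muleCA; apply: lee_wpmul2l; first by rewrite lee_fin ltW.
exact: tail_head_le.
Qed.

End one_space.

(** * Estimates for quasi-concave functions *)

(** Reduction to finite norms: an infinite one makes the bound trivial. *)
Lemma lee_mul_lin_real (R : realType) (D r : R) (x y z : \bar R) :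
  0 < D -> 0 < r -> (0 <= x)%E -> (0 <= y)%E ->
  (forall n m : R, 0 <= n -> 0 <= m -> x = n%:E -> y = m%:E ->
    (z <= (D * (n + r * m))%:E)%E) ->
  (z <= D%:E * (x + r%:E * y))%E.
Proof.
move=> D0 r0; case: x => [n| |//] x0; case: y => [m| |//] y0 H.
- by exact: H.
- by rewrite gt0_muley ?lte_fin// addey// gt0_muley ?lte_fin// leey.
- by rewrite addye// gt0_muley ?lte_fin// leey.
- by rewrite gt0_muley ?lte_fin// addye// gt0_muley ?lte_fin// leey.
Qed.

Section two_spaces.
Context {R : realType} (E0 E1 F0 F1 : ri_space R) (a0 a1 b0 b1 : R -> R)
  (theta0 theta1 : R).
Context (th0 : 0 < theta0) (th01 : theta0 < theta1) (th1 : theta1 < 1).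
Context (sa0 : sv_weight a0) (sa1 : sv_weight a1)
  (sb0 : sv_weight b0) (sb1 : sv_weight b1)
  (fin0 : (tilde_norm E0 `]1%R, +oo[ (EFin \o b0) < +oo)%E)
  (fin1 : (tilde_norm E1 `]1%R, +oo[ (EFin \o b1) < +oo)%E).
Implicit Types (k : R -> R) (u s t : R).

Local Notation B0 := (tail_norm E0 b0).
Local Notation B1 := (tail_norm E1 b1).
Local Notation w0 := (weighted theta0 a0).
Local Notation w1 := (weighted theta1 a1).
Local Notation I0 := (head_inner F0 a0 theta0).
Local Notation I1 := (head_inner F1 a1 theta1).
Local Notation N0 := (outer_norm E0 F0 a0 b0 theta0 (@posR R)).
Local Notation N1 := (outer_norm E1 F1 a1 b1 theta1 (@posR R)).
Local Notation rho := (rho theta0 theta1 E0 E1 a0 a1 b0 b1).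
Local Notation delta := (theta1 - theta0).

Definition near_term k u := outer_norm E0 F0 a0 b0 theta0 `]0, u[ k.

Definition middle_term k u := ((B0 u)%:E * I0 k u)%E.

Definition far_term k u :=
  tilde_norm E1 `]u, +oo[ (fun t => (b1 t)%:E * tilde_norm F1 `]u, t[ (w1 k))%E.

Let dlt : 0 < delta. Proof. by rewrite subr_gt0. Qed.

Let th1_gt0 : 0 < theta1. Proof. exact: lt_trans th01. Qed.

Let B0_gt0 u : 0 < u -> 0 < B0 u. Proof. exact: tail_norm_gt0. Qed.

Let B1_gt0 u : 0 < u -> 0 < B1 u. Proof. exact: tail_norm_gt0. Qed.

Lemma rho_gt0 u : 0 < u -> 0 < rho u.
Proof.
move=> u0; rewrite /rho mulr_gt0 ?powR_gt0// divr_gt0// mulr_gt0//.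
- exact: (svw_gt0 sa0).
- exact: B0_gt0.
- exact: (svw_gt0 sa1).
- exact: B1_gt0.
Qed.

Let g := a0 \* (fun t => ((a1 \* B1) t)^-1).

Let h := a1 \* (fun t => ((a0 \* B0) t)^-1).

Let sg : sv_weight g.
Proof.
apply: sv_weightM => //; apply: sv_weightV; apply: sv_weightM => //.
exact: sv_tail_norm.
Qed.

Let sh : sv_weight h.
Proof.
apply: sv_weightM => //; apply: sv_weightV; apply: sv_weightM => //.
exact: sv_tail_norm.
Qed.

(* [g] and [h] are the weights such that the pointwise bounds for [k1] and [k0]
   give the integrands [s ^ delta * g s] and [s ^ (- delta) * h s] of the inner
   norms in [F0] and [F1]; the two identities below are why [rho] balances
   them. *)
Let rhoEg u : 0 < u -> rho u = u `^ delta * g u * B0 u.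
Proof.
move=> u0; rewrite /rho /g /= -/(B0 u) -/(B1 u); field.
by rewrite !gt_eqF ?(svw_gt0 sa1) ?B1_gt0.
Qed.

Let rho_h u : 0 < u -> rho u * (u `^ (- delta) * h u * B1 u) = 1.
Proof.
move=> u0; rewrite /rho /h /= -/(B0 u) -/(B1 u) powRN; field.
by rewrite !gt_eqF ?(svw_gt0 sa1) ?(svw_gt0 sa0) ?B1_gt0 ?B0_gt0 ?powR_gt0.
Qed.

Lemma weighted_split (theta C : R) a k k0 k1 s : sv_weight a -> 0 < s ->
  k s <= C * (k0 s + k1 s) ->
  (weighted theta a k s <= C%:E * weighted theta a k0 s + C%:E * weighted theta a k1 s)%E.
Proof.
move=> sa s0 kle; rewrite /weighted -!EFinM -EFinD lee_fin.
have -> : C * (s `^ (- theta) * a s * k0 s) + C * (s `^ (- theta) * a s * k1 s) =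
  (s `^ (- theta) * a s) * (C * (k0 s + k1 s)) by ring.
by rewrite ler_wpM2l// mulr_ge0 ?powR_ge0 ?(ltW (svw_gt0 sa s0)).
Qed.

(** The part of [k] controlled by the right norm for a term is estimated by
    monotonicity.  The other part satisfies a pointwise power bound, and since
    the exponents differ the resulting weight grows on [(0, u)], respectively
    decays on [(u, +oo)], so that its norms are dominated by its value
    at [u]. *)
Lemma lower_estimate C : 0 < C -> exists2 D, 0 < D & forall k k0 k1 u,
  quasi_concave k -> quasi_concave k0 -> quasi_concave k1 -> 0 < u ->
  (forall s, 0 < s -> k s <= C * (k0 s + k1 s)) ->
  (near_term k u + middle_term k u + (rho u)%:E * far_term k u <=
   D%:E * (N0 k0 + (rho u)%:E * N1 k1))%E.
Proof.
move=> C0.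
have [C1 C10 hC1] := pointwise_le_outer_norm F1 sa1 sb1 th1_gt0 fin1.
have [C2 C20 hC2] := pointwise_le_outer_norm F0 sa0 sb0 th0 fin0.
have [C3 C30 hC3] := tilde_norm_head F0 sg dlt.
have [C4 C40 hC4] := tilde_norm_tail F1 sh dlt.
have [C5 C50 hC5] := tilde_norm_head E0 (sv_weightM sb0 sg) dlt.
have [C6 C60 hC6] := sv_le_tail sb0 fin0.
pose K1 := C * C1 * C3 * C5 * C6.
pose K2 := C * C1 * C3.
pose K3 := C * C2 * C4.
have K10 : 0 < K1 by rewrite !mulr_gt0.
have K20 : 0 < K2 by rewrite !mulr_gt0.
have K30 : 0 < K3 by rewrite !mulr_gt0.
exists (K1 + K2 + K3 + C + C + C); first by rewrite !addr_gt0.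
move=> k k0 k1 u qk qk0 qk1 u0 kle.
have r0 := rho_gt0 u0.
have pp := @pos_measurable_posR R.
set D := K1 + _ + _ + _ + _ + _.
have D0 : 0 < D by rewrite !addr_gt0.
have N0ge : (0 <= N0 k0)%E by exact: tilde_norm_ge0.
have N1ge : (0 <= N1 k1)%E by exact: tilde_norm_ge0.
apply: (lee_mul_lin_real D0 r0 N0ge N1ge) => n0 n1 n0ge n1ge N0E N1E.
(* The mismatched pairs: [k1] in the norms of [F0] and [k0] in those of [F1]. *)
have k1_bound s : 0 < s -> (w0 k1 s <= (C1 * n1)%:E * (s `^ delta * g s)%:E)%E.
  move=> s0; have := hC1 _ _ qk1 s0.
  rewrite N1E /weighted -!EFinM !lee_fin => hs.
  have gs := svw_gt0 sg s0.
  have c0 : 0 <= s `^ delta * g s by rewrite mulr_ge0 ?powR_ge0 ?(ltW gs).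
  apply: le_trans (ler_wpM2r c0 hs).
  rewrite le_eqVlt; apply/orP; left; apply/eqP.
  have -> : s `^ (- theta0) = s `^ delta * s `^ (- theta1).
    rewrite -powRD; last by rewrite (gt_eqF s0) implybT.
    by congr (_ `^ _); ring.
  rewrite /g /=; field.
  by rewrite !gt_eqF ?(svw_gt0 sa1) ?B1_gt0.
have k0_bound s : 0 < s -> (w1 k0 s <= (C2 * n0)%:E * (s `^ (- delta) * h s)%:E)%E.
  move=> s0; have := hC2 _ _ qk0 s0.
  rewrite N0E /weighted -!EFinM !lee_fin => hs.
  have hs0 := svw_gt0 sh s0.
  have c0 : 0 <= s `^ (- delta) * h s by rewrite mulr_ge0 ?powR_ge0 ?(ltW hs0).
  apply: le_trans (ler_wpM2r c0 hs).
  rewrite le_eqVlt; apply/orP; left; apply/eqP.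
  have -> : s `^ (- theta1) = s `^ (- delta) * s `^ (- theta0).
    rewrite -powRD; last by rewrite (gt_eqF s0) implybT.
    by congr (_ `^ _); ring.
  rewrite /h /=; field.
  by rewrite !gt_eqF ?(svw_gt0 sa0) ?B0_gt0.
have I0k t : 0 < t ->
    (I0 k t <= C%:E * I0 k0 t + (K2 * n1 * (t `^ delta * g t))%:E)%E.
  move=> t0; have pt := pos_measurable_oo t (lexx 0).
  apply: (@le_trans _ _ (C%:E * I0 k0 t + C%:E * I0 k1 t)%E).
    apply: (tilde_norm_lin2 F0 pt (ltW C0) (ltW C0));
      try exact: nneg_measurable_on_weighted.
    by move=> s /(posRP pt) s0; apply: weighted_split => //; exact: kle.
  apply: leeD2l.
  have I0k1 : (I0 k1 t <= (C1 * n1)%:E * (C3 * (t `^ delta * g t))%:E)%E.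
    have c1 : 0 <= C1 * n1 by rewrite mulr_ge0 ?(ltW C10).
    apply: (@le_trans _ _ ((C1 * n1)%:E *
        tilde_norm F0 `]0%R, t[ (fun s => (s `^ delta * g s)%:E))%E); last first.
      by apply: lee_wpmul2l; [rewrite lee_fin|exact: hC3].
    apply: (le_tilde_normZ F0 c1 pt).
    - exact: nneg_measurable_on_weighted.
    - exact: nneg_measurable_on_powR_weight.
    - by move=> s /(posRP pt); exact: k1_bound.
  apply: (@le_trans _ _ (C%:E * ((C1 * n1)%:E * (C3 * (t `^ delta * g t))%:E))%E).
    by apply: lee_wpmul2l; rewrite ?lee_fin ?(ltW C0).
  by rewrite -!EFinM lee_fin le_eqVlt /K2; apply/orP; left; apply/eqP; ring.
have gu := svw_gt0 sg u0.
have pu := pos_measurable_oo u (lexx 0).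
have puy := pos_measurable_oy (ltW u0).
have near_le : (near_term k u <= (C * n0 + K1 * (rho u * n1))%:E)%E.
  have c1 : 0 <= K2 * n1 by rewrite mulr_ge0 ?(ltW K20).
  apply: (@le_trans _ _ (C%:E * outer_norm E0 F0 a0 b0 theta0 `]0%R, u[ k0 +
      (K2 * n1)%:E * tilde_norm E0 `]0%R, u[ (fun t => (t `^ delta * (b0 \* g) t)%:E))%E).
    apply: (tilde_norm_lin2 E0 pu (ltW C0) c1).
    - exact: nneg_measurable_on_head.
    - exact: nneg_measurable_on_head.
    - exact: (nneg_measurable_on_powR_weight _ pu (sv_weightM sb0 sg)).
    - move=> t /(posRP pu) t0; have bt := svw_gt0 sb0 t0.
      have bt0 : (0 <= (b0 t)%:E)%E by rewrite lee_fin ltW.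
      apply: (le_trans (lee_wpmul2l bt0 (I0k t t0))).
      have nI : (0 <= I0 k0 t)%E by exact: tilde_norm_ge0.
      rewrite ge0_muleDr; last 2 first.
      - by rewrite mule_ge0// lee_fin ltW.
      - rewrite lee_fin; apply: (mulr_ge0 c1).
        exact: (mulr_ge0 (powR_ge0 _ _) (ltW (svw_gt0 sg t0))).
      rewrite muleCA; apply: leeD2l.
      by rewrite -!EFinM lee_fin le_eqVlt; apply/orP; left; apply/eqP; rewrite /=; ring.
  rewrite EFinD; apply: leeD.
    rewrite EFinM; apply: lee_wpmul2l; first by rewrite lee_fin ltW.
    rewrite -N0E; apply: (le_tilde_norm _ pu pp); last by [].
    - exact: nneg_measurable_on_head.
    - exact: nneg_measurable_on_head.
    - exact: pu.2.
  apply: (@le_trans _ _ ((K2 * n1)%:E * (C5 * (u `^ delta * (b0 \* g) u))%:E)%E).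
    by apply: lee_wpmul2l; [rewrite lee_fin|exact: hC5].
  rewrite -EFinM lee_fin (rhoEg u0) /K1 /=.
  have -> : C * C1 * C3 * C5 * C6 * (u `^ delta * g u * B0 u * n1) =
    (K2 * n1 * C5 * u `^ delta * g u) * (C6 * B0 u) by rewrite /K2; ring.
  have -> : K2 * n1 * (C5 * (u `^ delta * (b0 u * g u))) =
    (K2 * n1 * C5 * u `^ delta * g u) * b0 u by ring.
  apply: ler_wpM2l; last exact: hC6.
  apply: (mulr_ge0 _ (ltW gu)); apply: (mulr_ge0 _ (powR_ge0 _ _)).
  exact: (mulr_ge0 (mulr_ge0 (ltW K20) n1ge) (ltW C50)).
have middle_le : (middle_term k u <= (C * n0 + K2 * (rho u * n1))%:E)%E.
  have Bu := B0_gt0 u0.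
  have Bu0 : (0 <= (B0 u)%:E)%E by rewrite lee_fin ltW.
  apply: (le_trans (lee_wpmul2l Bu0 (I0k u u0))).
  have nI : (0 <= I0 k0 u)%E by exact: tilde_norm_ge0.
  rewrite ge0_muleDr; last 2 first.
  - by rewrite mule_ge0// lee_fin ltW.
  - rewrite lee_fin; apply: (mulr_ge0 (mulr_ge0 (ltW K20) n1ge)).
    exact: (mulr_ge0 (powR_ge0 _ _) (ltW gu)).
  rewrite EFinD; apply: leeD.
    rewrite muleCA EFinM; apply: lee_wpmul2l; first by rewrite lee_fin ltW.
    by rewrite -N0E; exact: tail_head_le.
  rewrite -EFinM lee_fin (rhoEg u0) le_eqVlt; apply/orP; left; apply/eqP; ring.
have far_le : ((rho u)%:E * far_term k u <= (K3 * n0 + C * (rho u * n1))%:E)%E.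
  have hu := svw_gt0 sh u0.
  pose c1 := K3 * n0 * (u `^ (- delta) * h u).
  have c10 : 0 <= c1.
    apply: (mulr_ge0 (mulr_ge0 (ltW K30) n0ge)).
    exact: (mulr_ge0 (powR_ge0 _ _) (ltW hu)).
  have far1 : (far_term k u <= c1%:E * (B1 u)%:E + C%:E * N1 k1)%E.
    apply: (@le_trans _ _ (c1%:E * tilde_norm E1 `]u, +oo[ (EFin \o b1) +
        C%:E * outer_norm E1 F1 a1 b1 theta1 `]u, +oo[ k1)%E); last first.
      rewrite (tail_normE sb1 fin1 u0); apply: leeD2l; apply: lee_wpmul2l.
        by rewrite lee_fin ltW.
      apply: (le_tilde_norm _ puy pp); last by [].
      - exact: nneg_measurable_on_head.
      - exact: nneg_measurable_on_head.
      - exact: puy.2.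
    apply: (tilde_norm_lin2 E1 puy c10 (ltW C0)).
    - apply: (nneg_measurable_on_outer puy sb1) => [t|s t _ st].
        exact: tilde_norm_ge0.
      apply: (inner_norm_mono F1 (ltW u0) _ st).
      exact: nneg_measurable_on_weighted.
    - exact: nneg_measurable_on_sv.
    - exact: nneg_measurable_on_head.
    - move=> t ut; have t0 := posRP puy ut; have bt := svw_gt0 sb1 t0.
      have bt0 : (0 <= (b1 t)%:E)%E by rewrite lee_fin ltW.
      have put := pos_measurable_oo t (ltW u0).
      have pt := pos_measurable_oo t (lexx 0).
      have inner : (tilde_norm F1 `]u, t[ (w1 k) <= c1%:E + C%:E * I1 k1 t)%E.
        apply: (@le_trans _ _ (C%:E * tilde_norm F1 `]u, t[ (w1 k0) +
            C%:E * tilde_norm F1 `]u, t[ (w1 k1))%E).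
          apply: (tilde_norm_lin2 F1 put (ltW C0) (ltW C0));
            try exact: nneg_measurable_on_weighted.
          by move=> s /(posRP put) s0; apply: weighted_split => //; exact: kle.
        apply: leeD; last first.
          apply: lee_wpmul2l; first by rewrite lee_fin ltW.
          apply: (le_tilde_norm _ put pt); last by [].
          - exact: nneg_measurable_on_weighted.
          - exact: nneg_measurable_on_weighted.
          - by move=> s /=; rewrite !in_itv/= => /andP[/(lt_trans u0)-> ->].
        have c2 : 0 <= C2 * n0 by rewrite mulr_ge0 ?(ltW C20).
        have inner0 : (tilde_norm F1 `]u, t[ (w1 k0) <=
            (C2 * n0)%:E * (C4 * (u `^ (- delta) * h u))%:E)%E.
          apply: (@le_trans _ _ ((C2 * n0)%:E *
              tilde_norm F1 `]u, +oo[ (fun s => (s `^ (- delta) * h s)%:E))%E); last first.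
            by apply: lee_wpmul2l; [rewrite lee_fin|exact: hC4].
          rewrite -(tilde_normZ _ c2 puy (nneg_measurable_on_powR_weight _ puy sh)).
          apply: (le_tilde_norm _ put puy).
          - exact: nneg_measurable_on_weighted.
          - apply: nneg_measurable_onZ; first by rewrite lee_fin.
            exact: nneg_measurable_on_powR_weight.
          - by move=> s /=; rewrite !in_itv/= => /andP[->].
          - by move=> s /(posRP put); exact: k0_bound.
        apply: (@le_trans _ _ (C%:E * ((C2 * n0)%:E * (C4 * (u `^ (- delta) * h u))%:E))%E).
          by apply: lee_wpmul2l; rewrite ?lee_fin ?(ltW C0).
        by rewrite -!EFinM lee_fin le_eqVlt /c1 /K3; apply/orP; left; apply/eqP; ring.
      apply: (le_trans (lee_wpmul2l bt0 inner)).
      have nI : (0 <= I1 k1 t)%E by exact: tilde_norm_ge0.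
      rewrite ge0_muleDr; last 2 first.
      - by rewrite lee_fin.
      - by rewrite mule_ge0// lee_fin ltW.
      by rewrite muleC [X in (_ + X <= _)%E]muleCA.
  apply: (le_trans (lee_wpmul2l _ far1)); first by rewrite lee_fin ltW.
  rewrite N1E -!EFinM lee_fin le_eqVlt; apply/orP; left; apply/eqP.
  rewrite mulrDr; congr (_ + _); last by ring.
  have -> : rho u * (c1 * B1 u) = K3 * n0 * (rho u * (u `^ (- delta) * h u * B1 u)).
    by rewrite /c1; ring.
  by rewrite (rho_h u0) mulr1.
apply: (le_trans (leeD (leeD near_le middle_le) far_le)).
rewrite -!EFinD lee_fin.
have q0 : 0 <= rho u * n1 by rewrite mulr_ge0 ?(ltW r0).
have -> : D * (n0 + rho u * n1) = C * n0 + K1 * (rho u * n1) +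
    (C * n0 + K2 * (rho u * n1)) + (K3 * n0 + C * (rho u * n1)) +
    ((K1 + K2 + C) * n0 + (K3 + C + C) * (rho u * n1)) by rewrite /D; ring.
have L0 : 0 <= K1 + K2 + C := addr_ge0 (addr_ge0 (ltW K10) (ltW K20)) (ltW C0).
have L1 : 0 <= K3 + C + C := addr_ge0 (addr_ge0 (ltW K30) (ltW C0)) (ltW C0).
by rewrite lerDl (addr_ge0 (mulr_ge0 L0 n0ge) (mulr_ge0 L1 q0)).
Qed.

(** [k0] and [k1] stand for the [K]-functionals of the two parts of a
    decomposition which is nearly optimal at [u]: the first behaves like [k]
    before [u] and is constant afterwards, the second is linear before [u] and
    behaves like [k] afterwards. The constant and linear pieces contribute a
    multiple of the weighted value of [k] at [u], which the middle term
    dominates by [weighted_le_head_norm]. *)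
Lemma upper_estimate C : 0 < C -> exists2 D, 0 < D & forall k k0 k1 u,
  quasi_concave k -> quasi_concave k0 -> quasi_concave k1 -> 0 < u ->
  (forall s, 0 < s -> s <= u -> k0 s <= C * k s) ->
  (forall s, u <= s -> k0 s <= C * k u) ->
  (forall s, 0 < s -> s <= u -> k1 s <= C * (k u / u) * s) ->
  (forall s, u <= s -> k1 s <= C * k s) ->
  (N0 k0 + (rho u)%:E * N1 k1 <=
   D%:E * (near_term k u + middle_term k u + (rho u)%:E * far_term k u))%E.
Proof.
move=> C0.
have th1' : 0 < 1 - theta1 by rewrite subr_gt0.
have [C1 C10 hC1] := tilde_norm_tail F0 sa0 th0.
have [C2 C20 hC2] := weighted_le_head_norm F0 sa0 th0.
have [C3 C30 hC3] := tilde_norm_head F1 sa1 th1'.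
have [C4 C40 hC4] := tilde_norm_head E1 (sv_weightM sb1 sa1) th1'.
have [C5 C50 hC5] := sv_le_tail sb1 fin1.
pose M := C + C * C1 * C2.
pose K := C * C3 * C4 * C5 + C * C3.
have M0 : 0 < M by rewrite addr_gt0 ?mulr_gt0.
have K0 : 0 < K by rewrite addr_gt0 ?mulr_gt0.
exists (C + (M + K * C2)); first by rewrite !addr_gt0 ?mulr_gt0.
move=> k k0 k1 u qk qk0 qk1 u0 k0_head k0_tail k1_head k1_tail.
have r0 := rho_gt0 u0.
have pp := @pos_measurable_posR R.
have pu := pos_measurable_oo u (lexx 0).
have puy := pos_measurable_oy (ltW u0).
have ku := qc_ge0 qk u0.
have kuu : 0 <= C * (k u / u) := mulr_ge0 (ltW C0) (divr_ge0 ku (ltW u0)).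
have au0 := svw_gt0 sa0 u0.
have au1 := svw_gt0 sa1 u0.
have Bu0 := B0_gt0 u0.
have Bu1 := B1_gt0 u0.
pose X := I0 k u.
have X0 : (0 <= X)%E by exact: tilde_norm_ge0.
have wX : (w0 k u <= C2%:E * X)%E by exact: hC2.
have posR_split s : @posR R s -> s != u -> `]0, u[%classic s \/ `]u, +oo[%classic s.
  rewrite /posR/= !in_itv/= !andbT => ->.
  by rewrite neq_lt => /orP[]; [left|right].
have N0_le : (N0 k0 <= C%:E * near_term k u + M%:E * middle_term k u)%E.
  apply: le_trans (tilde_norm_cover E0 (u := u) pp pu puy _ _ _ posR_split) _;
    try exact: nneg_measurable_on_head.
  apply: leeD.
    apply: (le_tilde_normZ E0 (ltW C0) pu).
    - exact: nneg_measurable_on_head.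
    - exact: nneg_measurable_on_head.
    - move=> t /= /[!in_itv]/= /andP[t0 tu]; have pt := pos_measurable_oo t (lexx 0).
      have bt : (0 <= (b0 t)%:E)%E by rewrite lee_fin (ltW (svw_gt0 sb0 t0)).
      rewrite muleCA; apply: (lee_wpmul2l bt).
      apply: (le_tilde_normZ F0 (ltW C0) pt).
      - exact: nneg_measurable_on_weighted.
      - exact: nneg_measurable_on_weighted.
      - move=> s /= /[!in_itv]/= /andP[s0 st]; rewrite /weighted -EFinM lee_fin.
        rewrite mulrCA ler_wpM2l//; last first.
          by apply: k0_head => //; rewrite ltW// (lt_trans st).
        exact: (mulr_ge0 (powR_ge0 _ _) (ltW (svw_gt0 sa0 s0))).
  have tail t : u < t -> (I0 k0 t <= M%:E * X)%E.
    move=> ut; have t0 := lt_trans u0 ut.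
    have pt := pos_measurable_oo t (lexx 0).
    have put := pos_measurable_oo t (ltW u0).
    have sp s : `]0, t[%classic s -> s != u -> `]0, u[%classic s \/ `]u, t[%classic s.
      rewrite /= !in_itv/= => /andP[-> ->]; rewrite andbT.
      by rewrite neq_lt => /orP[]; [left|right].
    apply: le_trans (tilde_norm_cover F0 (u := u) pt pu put _ _ _ sp) _;
      try exact: nneg_measurable_on_weighted.
    rewrite /M EFinD ge0_muleDl ?lee_fin ?(ltW C0)//; last first.
      by rewrite !mulr_ge0 ?(ltW C0) ?(ltW C10) ?(ltW C20).
    apply: leeD.
      apply: (le_tilde_normZ F0 (ltW C0) pu).
      - exact: nneg_measurable_on_weighted.
      - exact: nneg_measurable_on_weighted.
      - move=> s /= /[!in_itv]/= /andP[s0 su]; rewrite /weighted -EFinM lee_fin.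
        rewrite mulrCA ler_wpM2l//; last by apply: k0_head => //; exact: ltW.
        exact: (mulr_ge0 (powR_ge0 _ _) (ltW (svw_gt0 sa0 s0))).
    have ck : 0 <= C * k u := mulr_ge0 (ltW C0) ku.
    apply: (@le_trans _ _ ((C * k u)%:E *
        tilde_norm F0 `]u, +oo[ (fun s => (s `^ (- theta0) * a0 s)%:E))%E).
      rewrite -(tilde_normZ _ ck puy (nneg_measurable_on_powR_weight _ puy sa0)).
      apply: (le_tilde_norm _ put puy).
      - exact: nneg_measurable_on_weighted.
      - apply: nneg_measurable_onZ; first by rewrite lee_fin.
        exact: nneg_measurable_on_powR_weight.
      - by move=> s /=; rewrite !in_itv/= => /andP[->].
      - move=> s /= /[!in_itv]/= /andP[us st]; have s0 := lt_trans u0 us.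
        rewrite /weighted -EFinM lee_fin mulrC ler_wpM2r//.
          exact: (mulr_ge0 (powR_ge0 _ _) (ltW (svw_gt0 sa0 s0))).
        by apply: k0_tail; exact: ltW.
    apply: (@le_trans _ _ ((C * k u)%:E * (C1 * (u `^ (- theta0) * a0 u))%:E)%E).
      by apply: lee_wpmul2l; [rewrite lee_fin|exact: hC1].
    have -> : ((C * k u)%:E * (C1 * (u `^ (- theta0) * a0 u))%:E)%E =
        ((C * C1)%:E * w0 k u)%E.
      by rewrite /weighted -!EFinM; congr EFin; ring.
    rewrite [in X in (_ <= X)%E]EFinM -muleA.
    apply: lee_wpmul2l => //; rewrite lee_fin.
    exact: (mulr_ge0 (ltW C0) (ltW C10)).
  have nb := nneg_measurable_on_sv puy sb0.
  have MX : (0 <= M%:E * X)%E by rewrite mule_ge0// lee_fin ltW.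
  have Ngt0 : (0 < tilde_norm E0 `]u, +oo[ (EFin \o b0))%E.
    by rewrite -(tail_normE sb0 fin0 u0) lte_fin.
  have -> : (M%:E * middle_term k u)%E =
      (M%:E * X * tilde_norm E0 `]u, +oo[ (EFin \o b0))%E.
    by rewrite /middle_term (tail_normE sb0 fin0 u0) [Y in (M%:E * Y)%E]muleC muleA.
  rewrite -(tilde_normZe MX puy nb Ngt0).
  apply: (le_tilde_norm _ puy puy).
  - exact: nneg_measurable_on_head.
  - exact: nneg_measurable_onZ.
  - by [].
  - move=> t ut; have t0 := posRP puy ut; rewrite /= in_itv/= andbT in ut.
    rewrite muleC [X in (_ <= X)%E]/=; apply: lee_wpmul2r; last exact: tail.
    by rewrite lee_fin (ltW (svw_gt0 sb0 t0)).
(* [rho u * Z] is [B0 u] times the weighted value of [k] at [u]. *)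
pose Z := k u * u `^ (- theta1) * a1 u * B1 u.
have upow : u `^ (1 - theta1) = u * u `^ (- theta1).
  by rewrite powRD ?(gt_eqF u0) ?implybT// powRr1// ltW.
have I1_head t : 0 < t -> t <= u ->
    (I1 k1 t <= (C * (k u / u))%:E * (C3 * (t `^ (1 - theta1) * a1 t))%:E)%E.
  move=> t0 tu; have pt := pos_measurable_oo t (lexx 0).
  apply: (@le_trans _ _ ((C * (k u / u))%:E *
      tilde_norm F1 `]0%R, t[ (fun s => (s `^ (1 - theta1) * a1 s)%:E))%E); last first.
    by apply: lee_wpmul2l; [rewrite lee_fin|exact: hC3].
  apply: (le_tilde_normZ F1 kuu pt).
  - exact: nneg_measurable_on_weighted.
  - exact: nneg_measurable_on_powR_weight.
  - move=> s /= /[!in_itv]/= /andP[s0 st]; rewrite /weighted -EFinM lee_fin.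
    have -> : s `^ (1 - theta1) = s * s `^ (- theta1).
      by rewrite powRD ?(gt_eqF s0) ?implybT// powRr1// ltW.
    have -> : C * (k u / u) * (s * s `^ (- theta1) * a1 s) =
        s `^ (- theta1) * a1 s * (C * (k u / u) * s) by ring.
    rewrite ler_wpM2l//.
      exact: (mulr_ge0 (powR_ge0 _ _) (ltW (svw_gt0 sa1 s0))).
    by apply: k1_head => //; rewrite ltW// (lt_le_trans st).
have N1_le : (N1 k1 <= (K * Z)%:E + C%:E * far_term k u)%E.
  apply: le_trans (tilde_norm_cover E1 (u := u) pp pu puy _ _ _ posR_split) _;
    try exact: nneg_measurable_on_head.
  rewrite /K mulrDl EFinD -addeA; apply: leeD.
    have c1 : 0 <= C * (k u / u) * C3 := mulr_ge0 kuu (ltW C30).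
    apply: (@le_trans _ _ ((C * (k u / u) * C3)%:E *
        tilde_norm E1 `]0%R, u[ (fun t => (t `^ (1 - theta1) * (b1 \* a1) t)%:E))%E).
      apply: (le_tilde_normZ E1 c1 pu).
      - exact: nneg_measurable_on_head.
      - exact: (nneg_measurable_on_powR_weight _ pu (sv_weightM sb1 sa1)).
      - move=> t /= /[!in_itv]/= /andP[t0 tu].
        have bt : (0 <= (b1 t)%:E)%E by rewrite lee_fin (ltW (svw_gt0 sb1 t0)).
        apply: (le_trans (lee_wpmul2l bt (I1_head _ t0 (ltW tu)))).
        by rewrite -!EFinM lee_fin le_eqVlt; apply/orP; left; apply/eqP; ring.
    apply: (@le_trans _ _ ((C * (k u / u) * C3)%:E *
        (C4 * (u `^ (1 - theta1) * (b1 \* a1) u))%:E)%E).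
      by apply: lee_wpmul2l; [rewrite lee_fin|exact: hC4].
    rewrite -EFinM lee_fin upow /Z /=.
    have -> : C * (k u / u) * C3 * (C4 * (u * u `^ (- theta1) * (b1 u * a1 u))) =
        C * C3 * C4 * (k u * (u `^ (- theta1) * a1 u)) * b1 u.
      by field; rewrite gt_eqF.
    have -> : C * C3 * C4 * C5 * (k u * u `^ (- theta1) * a1 u * B1 u) =
        C * C3 * C4 * (k u * (u `^ (- theta1) * a1 u)) * (C5 * B1 u) by ring.
    apply: ler_wpM2l; last exact: hC5.
    apply: mulr_ge0; first by rewrite !mulr_ge0 ?(ltW C0) ?(ltW C30) ?(ltW C40).
    exact: (mulr_ge0 ku (mulr_ge0 (powR_ge0 _ _) (ltW au1))).
  pose c1 := C * C3 * (k u * u `^ (- theta1) * a1 u).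
  have c10 : 0 <= c1.
    apply: (mulr_ge0 (mulr_ge0 (ltW C0) (ltW C30))).
    exact: (mulr_ge0 (mulr_ge0 ku (powR_ge0 _ _)) (ltW au1)).
  have -> : ((C * C3 * Z)%:E = c1%:E * tilde_norm E1 `]u, +oo[ (EFin \o b1))%E.
    by rewrite -(tail_normE sb1 fin1 u0) -EFinM /c1 /Z; congr EFin; ring.
  apply: (tilde_norm_lin2 E1 puy c10 (ltW C0)).
  - exact: nneg_measurable_on_head.
  - exact: nneg_measurable_on_sv.
  - apply: (nneg_measurable_on_outer puy sb1) => [t|s t _ st].
      exact: tilde_norm_ge0.
    apply: (inner_norm_mono F1 (ltW u0) _ st).
    exact: nneg_measurable_on_weighted.
  - move=> t ut; have t0 := posRP puy ut; rewrite /= in_itv/= andbT in ut.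
    have bt : (0 <= (b1 t)%:E)%E by rewrite lee_fin (ltW (svw_gt0 sb1 t0)).
    have pt := pos_measurable_oo t (lexx 0).
    have put := pos_measurable_oo t (ltW u0).
    have sp s : `]0, t[%classic s -> s != u -> `]0, u[%classic s \/ `]u, t[%classic s.
      rewrite /= !in_itv/= => /andP[-> ->]; rewrite andbT.
      by rewrite neq_lt => /orP[]; [left|right].
    have inner : (I1 k1 t <= c1%:E + C%:E * tilde_norm F1 `]u, t[ (w1 k))%E.
      apply: le_trans (tilde_norm_cover F1 (u := u) pt pu put _ _ _ sp) _;
        try exact: nneg_measurable_on_weighted.
      apply: leeD.
        apply: (le_trans (I1_head _ u0 (lexx u))).
        rewrite -EFinM lee_fin upow le_eqVlt; apply/orP; left; apply/eqP.
        by rewrite /c1; field; rewrite gt_eqF.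
      apply: (le_tilde_normZ F1 (ltW C0) put).
      - exact: nneg_measurable_on_weighted.
      - exact: nneg_measurable_on_weighted.
      - move=> s /= /[!in_itv]/= /andP[us st]; have s0 := lt_trans u0 us.
        rewrite /weighted -EFinM lee_fin.
        rewrite mulrCA ler_wpM2l//; last by apply: k1_tail; exact: ltW.
        exact: (mulr_ge0 (powR_ge0 _ _) (ltW (svw_gt0 sa1 s0))).
    apply: (le_trans (lee_wpmul2l bt inner)).
    have nI : (0 <= tilde_norm F1 `]u, t[ (w1 k))%E by exact: tilde_norm_ge0.
    rewrite ge0_muleDr; last 2 first.
    - by rewrite lee_fin.
    - by rewrite mule_ge0// lee_fin ltW.
    by rewrite muleC [X in (_ + X <= _)%E]muleCA.
have rZ : ((rho u * (K * Z))%:E <= (K * C2)%:E * middle_term k u)%E.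
  have -> : (rho u * (K * Z))%:E = ((K * B0 u)%:E * w0 k u)%E.
    rewrite /weighted -EFinM; congr EFin; rewrite /Z /rho -/(B0 u) -/(B1 u).
    have -> : u `^ (- theta0) = u `^ delta * u `^ (- theta1).
      rewrite -powRD; last by rewrite (gt_eqF u0) implybT.
      by congr (_ `^ _); ring.
    by field; rewrite !gt_eqF.
  have KB : (0 <= (K * B0 u)%:E)%E by rewrite lee_fin mulr_ge0 ?(ltW K0) ?(ltW Bu0).
  apply: (le_trans (lee_wpmul2l KB wX)).
  rewrite /middle_term -/X !EFinM -!muleA.
  by apply: lee_wpmul2l; rewrite ?lee_fin ?(ltW K0)// muleCA.
have t1 : (0 <= near_term k u)%E by exact: tilde_norm_ge0.
have t2 : (0 <= middle_term k u)%E by rewrite mule_ge0// lee_fin ltW.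
have t3 : (0 <= (rho u)%:E * far_term k u)%E.
  by rewrite mule_ge0 ?lee_fin ?(ltW r0)//; exact: tilde_norm_ge0.
have D1 : C <= C + (M + K * C2) by rewrite lerDl addr_ge0 ?mulr_ge0 ?(ltW M0) ?(ltW K0) ?(ltW C20).
have D2 : M + K * C2 <= C + (M + K * C2) by rewrite lerDr ltW.
have rN1 := lee_wpmul2l (_ : (0 <= (rho u)%:E)%E) N1_le.
apply: (@le_trans _ _ ((C%:E * near_term k u + M%:E * middle_term k u) +
    ((K * C2)%:E * middle_term k u + C%:E * ((rho u)%:E * far_term k u)))%E).
  apply: leeD => //; apply: (le_trans (rN1 _)); first by rewrite lee_fin ltW.
  have f0 : (0 <= far_term k u)%E by exact: tilde_norm_ge0.
  rewrite muleDr ?fin_num_adde_defr// -EFinM muleCA.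
  exact: leeD.
set T1 := near_term k u in t1 *; set T2 := middle_term k u in t2 *.
set T3 := ((rho u)%:E * far_term k u)%E in t3 *.
have -> : (C%:E * T1 + M%:E * T2 + ((K * C2)%:E * T2 + C%:E * T3) =
   C%:E * T1 + (M + K * C2)%:E * T2 + C%:E * T3)%E.
  rewrite (EFinD M) ge0_muleDl ?lee_fin ?(ltW M0)//; last first.
    by rewrite mulr_ge0 ?(ltW K0) ?(ltW C20).
  by rewrite !addeA.
rewrite !muleDr ?ge0_adde_def ?inE ?adde_ge0//.
apply: leeD; [apply: leeD|]; by apply: lee_wpmul2r => //; rewrite lee_fin.
Qed.

End two_spaces.

(** * The K-functional of a quasi-Banach couple *)

Section K_functional.
Context {R : realType} (V : topologicalLmodType R) (X0 X1 : quasi_banach V).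
Implicit Types (f x y : V) (s t u : R).

Definition Kval f t : R := fine (Kfun X0 X1 t f).

Lemma qb_normEfin (X : quasi_banach V) x : mem_space X x ->
  X x = (fine (X x))%:E.
Proof. by move=> Xx; rewrite fineK// ge0_fin_numE// qb_norm_ge0. Qed.

Lemma fine_qb_norm_ge0 (X : quasi_banach V) x : 0 <= fine (X x).
Proof. by apply: fine_ge0; exact: qb_norm_ge0. Qed.

Lemma qb_norm0 (X : quasi_banach V) : X 0 = 0%E.
Proof. exact/qb_norm_eq0. Qed.

Lemma mem_space0 (X : quasi_banach V) : mem_space X 0.
Proof. by rewrite /mem_space/= qb_norm0 ltry. Qed.

Lemma qb_normN (X : quasi_banach V) x : X (- x) = X x.
Proof. by rewrite -scaleN1r qb_normZ normrN1 mul1e. Qed.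

Lemma mem_spaceN (X : quasi_banach V) x : mem_space X x -> mem_space X (- x).
Proof. by rewrite /mem_space/= qb_normN. Qed.

Lemma Kfun_ge0 f t : 0 < t -> (0 <= Kfun X0 X1 t f)%E.
Proof.
move=> t0; apply: le_ereal_inf_tmp => _ [f0 [f1 [_ _ _ ->]]].
by rewrite adde_ge0 ?qb_norm_ge0// mule_ge0 ?qb_norm_ge0// lee_fin ltW.
Qed.

Lemma Kfun_le f0 f1 t : 0 < t -> mem_space X0 f0 -> mem_space X1 f1 ->
  (Kfun X0 X1 t (f0 + f1) <= (fine (X0 f0) + t * fine (X1 f1))%:E)%E.
Proof.
move=> t0 m0 m1; rewrite EFinD EFinM -!qb_normEfin//.
by apply: ereal_inf_lbound; exists f0, f1.
Qed.

Lemma Kfun_fin_num f t : sum_space X0 X1 f -> 0 < t ->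
  Kfun X0 X1 t f \is a fin_num.
Proof.
move=> [f0 [f1 [m0 m1 ->]]] t0; rewrite (ge0_fin_numE (Kfun_ge0 _ t0)).
by apply: le_lt_trans (Kfun_le t0 m0 m1) _; exact: ltry.
Qed.

Lemma KfunE f t : sum_space X0 X1 f -> 0 < t -> Kfun X0 X1 t f = (Kval f t)%:E.
Proof. by move=> sf t0; rewrite /Kval fineK// Kfun_fin_num. Qed.

Lemma K_le f f0 f1 t : 0 < t -> mem_space X0 f0 -> mem_space X1 f1 ->
  f = f0 + f1 -> Kval f t <= fine (X0 f0) + t * fine (X1 f1).
Proof.
move=> t0 m0 m1 ->; rewrite -lee_fin -KfunE//; first exact: Kfun_le.
by exists f0, f1.
Qed.

Lemma K_ge f t (z : R) : sum_space X0 X1 f -> 0 < t ->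
  (forall f0 f1, mem_space X0 f0 -> mem_space X1 f1 -> f = f0 + f1 ->
    z <= fine (X0 f0) + t * fine (X1 f1)) ->
  z <= Kval f t.
Proof.
move=> sf t0 H; rewrite -lee_fin -KfunE//.
apply: le_ereal_inf_tmp => _ [f0 [f1 [m0 m1 fE ->]]].
by rewrite qb_normEfin// (qb_normEfin m1) -EFinM -EFinD lee_fin; exact: H.
Qed.

Lemma quasi_concave_K f : sum_space X0 X1 f -> quasi_concave (Kval f).
Proof.
move=> sf; split => [t t0|s t s0 st|s t s0 st].
- by apply: fine_ge0; exact: Kfun_ge0.
- have t0 := lt_le_trans s0 st; apply: K_ge => // f0 f1 m0 m1 fE.
  apply: (le_trans (K_le s0 m0 m1 fE)).
  by rewrite lerD2l ler_wpM2r// fine_qb_norm_ge0.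
- have t0 := lt_le_trans s0 st.
  rewrite -ler_pdivrMl// mulrA; apply: K_ge => // f0 f1 m0 m1 fE.
  rewrite -mulrA ler_pdivrMl//.
  apply: (le_trans (ler_wpM2l (ltW s0) (K_le t0 m0 m1 fE))).
  rewrite !mulrDr mulrCA lerD2r ler_wpM2r// fine_qb_norm_ge0//.
Qed.

(** The sum of the two quasi-norm constants serves for both spaces. *)
Lemma K_triangle : exists2 C, 1 <= C & forall f g t,
  sum_space X0 X1 f -> sum_space X0 X1 g -> 0 < t ->
  Kval (f + g) t <= C * (Kval f t + Kval g t).
Proof.
have [c0 c01 hc0] := qb_normD X0; have [c1 c11 hc1] := qb_normD X1.
pose C := c0 + c1.
have C1 : 1 <= C by rewrite /C; lra.
have C0 : 0 < C by exact: lt_le_trans C1.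
exists C => // f g t sf sg t0.
have step f0 f1 g0 g1 : mem_space X0 f0 -> mem_space X1 f1 -> f = f0 + f1 ->
    mem_space X0 g0 -> mem_space X1 g1 -> g = g0 + g1 ->
    Kval (f + g) t / C <= (fine (X0 f0) + t * fine (X1 f1)) + (fine (X0 g0) + t * fine (X1 g1)).
  move=> mf0 mf1 fE mg0 mg1 gE.
  have aux (X : quasi_banach V) c x y : 1 <= c -> c <= C ->
      (forall x y, X (x + y)%R <= c%:E * (X x + X y))%E ->
      mem_space X x -> mem_space X y ->
      mem_space X (x + y) /\ fine (X (x + y)) <= C * (fine (X x) + fine (X y)).
    move=> c_ge1 cC hc mx my; have := hc x y.
    rewrite (qb_normEfin mx) (qb_normEfin my) -EFinD -EFinM => le_xy.
    have mxy : mem_space X (x + y) by apply: le_lt_trans le_xy _; exact: ltry.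
    split => //; move: le_xy; rewrite qb_normEfin// lee_fin => /le_trans; apply.
    by rewrite ler_wpM2r// addr_ge0// fine_qb_norm_ge0.
  have c0C : c0 <= C by rewrite /C; lra.
  have c1C : c1 <= C by rewrite /C; lra.
  have [m0 le0] := aux _ _ _ _ c01 c0C hc0 mf0 mg0.
  have [m1 le1] := aux _ _ _ _ c11 c1C hc1 mf1 mg1.
  rewrite ler_pdivrMr// mulrC.
  apply: (le_trans (K_le t0 m0 m1 _)); first by rewrite fE gE addrACA.
  apply: (le_trans (lerD le0 (ler_wpM2l (ltW t0) le1))).
  by rewrite le_eqVlt; apply/orP; left; apply/eqP; ring.
rewrite mulrC -ler_pdivrMr//.
rewrite -lerBlDr; apply: K_ge => // f0 f1 mf0 mf1 fE.
rewrite lerBlDr [X in _ <= X]addrC -lerBlDr; apply: K_ge => // g0 g1 mg0 mg1 gE.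
by rewrite lerBlDr [X in _ <= X]addrC; exact: step.
Qed.

(** If the [K]-functional vanishes at [u], then [f] is a sum of two vectors of
    arbitrarily small norm; by the continuity of the embeddings it lies in every
    neighbourhood of the origin, and the ambient space is separated. *)
Lemma K_eq0 f u : hausdorff_space V -> sum_space X0 X1 f -> 0 < u ->
  Kval f u = 0 -> f = 0.
Proof.
move=> hV sf u0 K0; apply/esym; apply: hV => A B A0 Bf.
suff Af : A f by exists f; split => //; exact: nbhs_singleton.
have := @add_continuous V (0, 0); rewrite /continuous_at/= addr0 => /(_ A A0).
move=> [[U0 U1] [/= nU0 nU1] UA].
have [d0 d00 hd0] := @qb_embedding _ _ X0 _ nU0.
have [d1 d10 hd1] := @qb_embedding _ _ X1 _ nU1.
pose e := Num.min d0 (u * d1).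
have e0 : 0 < e by rewrite lt_min d00 mulr_gt0.
apply: contrapT => nAf.
suff : e <= Kval f u by rewrite K0 leNgt e0.
apply: K_ge => // f0 f1 m0 m1 fE; rewrite leNgt; apply/negP => lte.
apply: nAf; rewrite fE; apply: (UA (f0, f1)); split => /=.
- apply: hd0; rewrite qb_normEfin// lte_fin.
  have : fine (X0 f0) < e.
    by apply: le_lt_trans lte; rewrite lerDl mulr_ge0 ?(ltW u0)// fine_qb_norm_ge0.
  by rewrite lt_min => /andP[].
- apply: hd1; rewrite qb_normEfin// lte_fin -(ltr_pM2l u0).
  have : u * fine (X1 f1) < e.
    by apply: le_lt_trans lte; rewrite lerDr fine_qb_norm_ge0.
  by rewrite lt_min => /andP[].
Qed.

(** The factor 2 leaves room for a decomposition as soon as the infimum is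
    positive; if it is zero then [f = 0] by [K_eq0]. *)
Lemma K_decomposition f u : hausdorff_space V -> sum_space X0 X1 f -> 0 < u ->
  exists f0 f1, [/\ mem_space X0 f0, mem_space X1 f1, f = f0 + f1 &
    fine (X0 f0) + u * fine (X1 f1) <= 2 * Kval f u].
Proof.
move=> hV sf u0; have := qc_ge0 (quasi_concave_K sf) u0.
rewrite le_eqVlt => /predU1P[/esym K0|Kpos].
  exists 0, 0; split; [exact: mem_space0|exact: mem_space0| |].
    by rewrite addr0; exact: K_eq0 K0.
  by rewrite K0 !qb_norm0/= !mulr0 addr0.
apply: contrapT => nex.
suff : 2 * Kval f u <= Kval f u by lra.
apply: K_ge => // f0 f1 m0 m1 fE; rewrite leNgt; apply/negP => lt2.
by apply: nex; exists f0, f1; split => //; exact: ltW.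
Qed.

End K_functional.

Section weighted_K.
Context {R : realType} (V : topologicalLmodType R) (X0 X1 : quasi_banach V).
Implicit Types (f : V) (E F : ri_space R).

Lemma weighted_KE theta a f s : sum_space X0 X1 f -> 0 < s ->
  weighted_K X0 X1 theta a f s = weighted theta a (Kval X0 X1 f) s.
Proof. by move=> sf s0; rewrite /weighted_K (KfunE sf s0) -EFinM. Qed.

Lemma tilde_norm_weighted_K F (I : set R) theta a f : sum_space X0 X1 f ->
  I `<=` @posR R ->
  tilde_norm F I (weighted_K X0 X1 theta a f) =
  tilde_norm F I (weighted theta a (Kval X0 X1 f)).
Proof.
move=> sf Ip; apply: tilde_norm_ext => s /Ip; rewrite /posR/= in_itv/= andbT.
exact: weighted_KE.
Qed.

Lemma tilde_norm_inner_K E F (I : set R) theta a b v f : sum_space X0 X1 f ->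
  0 <= v ->
  tilde_norm E I (fun t => (b t)%:E *
    tilde_norm F `]v, t[ (weighted_K X0 X1 theta a f))%E =
  tilde_norm E I (fun t => (b t)%:E *
    tilde_norm F `]v, t[ (weighted theta a (Kval X0 X1 f)))%E.
Proof.
move=> sf v0; apply: tilde_norm_ext => t _.
by rewrite (tilde_norm_weighted_K F theta a sf (pos_measurable_oo t v0).2).
Qed.

Lemma XL_normE E F theta a b f : sum_space X0 X1 f ->
  XL_norm X0 X1 theta b E a F f =
  outer_norm E F a b theta (@posR R) (Kval X0 X1 f).
Proof.
move=> sf; rewrite /XL_norm (asboolT sf).
by rewrite (tilde_norm_inner_K E F _ theta a b sf (lexx 0)).
Qed.

Lemma XL_norm_sum_space E F theta a b f :
  mem_space (XL_norm X0 X1 theta b E a F) f -> sum_space X0 X1 f.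
Proof. by rewrite /mem_space /XL_norm/=; case: asboolP. Qed.

End weighted_K.

(** * The equivalence *)

Lemma sum_spaceD (R : realType) (V : topologicalLmodType R)
  (X0 X1 : quasi_banach V) (f g : V) :
  sum_space X0 X1 f -> sum_space X0 X1 g -> sum_space X0 X1 (f + g).
Proof.
have memD (X : quasi_banach V) x y :
    mem_space X x -> mem_space X y -> mem_space X (x + y).
  move=> mx my; have [c _ hc] := qb_normD X.
  apply: le_lt_trans (hc x y) _.
  by rewrite (qb_normEfin mx) (qb_normEfin my) -EFinD -EFinM ltry.
move=> [f0 [f1 [mf0 mf1 ->]]] [g0 [g1 [mg0 mg1 ->]]].
exists (f0 + g0), (f1 + g1); rewrite addrACA; split => //; exact: memD.
Qed.

Theorem theorem3p2 (R : realType)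
  (V : topologicalLmodType R) (hV : hausdorff_space V) (X0 X1 : quasi_banach V)
  (theta0 theta1 : R)
  (htheta0 : 0 < theta0) (htheta : theta0 < theta1) (htheta1 : theta1 < 1)
  (E0 E1 F0 F1 : ri_space R) (a0 a1 b0 b1 : R -> R)
  (ha0 : slowly_varying a0) (ha1 : slowly_varying a1)
  (hb0 : slowly_varying b0) (hb1 : slowly_varying b1)
  (hbE0 : (tilde_norm E0 `]1%R, +oo[ (EFin \o b0) < +oo)%E)
  (hbE1 : (tilde_norm E1 `]1%R, +oo[ (EFin \o b1) < +oo)%E) :
  let Y0 := XL_norm X0 X1 theta0 b0 E0 a0 F0 in
  let Y1 := XL_norm X0 X1 theta1 b1 E1 a1 F1 in
  let rho_ := rho theta0 theta1 E0 E1 a0 a1 b0 b1 in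
  let rhs := fun (f : V) (u : R) =>
    (tilde_norm E0 `]0%R, u[ (fun t : R =>
       (b0 t)%:E * tilde_norm F0 `]0%R, t[ (weighted_K X0 X1 theta0 a0 f))
     + tilde_norm E0 `]u, +oo[ (EFin \o b0)
       * tilde_norm F0 `]0%R, u[ (weighted_K X0 X1 theta0 a0 f)
     + (rho_ u)%:E * tilde_norm E1 `]u, +oo[ (fun t : R =>
         (b1 t)%:E * tilde_norm F1 `]u, t[ (weighted_K X0 X1 theta1 a1 f)))%E in
  exists2 c : R, 0 < c &
    forall (f : V) (u : R), sum_space Y0 Y1 f -> 0 < u ->
      (Kfun Y0 Y1 (rho_ u) f <= c%:E * rhs f u)%E /\
      (rhs f u <= c%:E * Kfun Y0 Y1 (rho_ u) f)%E.
Proof.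
move=> Y0 Y1 rho_ rhs.
have sa0 := slowly_varying_weight ha0; have sa1 := slowly_varying_weight ha1.
have sb0 := slowly_varying_weight hb0; have sb1 := slowly_varying_weight hb1.
have [Ct Ct1 hCt] := K_triangle X0 X1.
have Ct0 : 0 < Ct by exact: lt_le_trans Ct1.
have C0 : 0 < 3 * Ct by rewrite mulr_gt0.
have [D1 D10 upper] := upper_estimate F0 F1 htheta0 htheta1
  sa0 sa1 sb0 sb1 hbE0 hbE1 C0.
have [D2 D20 lower] := lower_estimate F0 F1 htheta0 htheta
  sa0 sa1 sb0 sb1 hbE0 hbE1 Ct0.
pose near f u := near_term E0 F0 a0 b0 theta0 (Kval X0 X1 f) u.
pose middle f u := middle_term E0 F0 a0 b0 theta0 (Kval X0 X1 f) u.
pose far f u := far_term E1 F1 a1 b1 theta1 (Kval X0 X1 f) u.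
have rhsE f u : sum_space X0 X1 f -> 0 < u ->
    rhs f u = (near f u + middle f u + (rho_ u)%:E * far f u)%E.
  move=> sf u0; rewrite /rhs /middle /middle_term (tail_normE sb0 hbE0 u0).
  rewrite (tilde_norm_weighted_K F0 theta0 a0 sf (pos_measurable_oo u (lexx 0)).2).
  rewrite (tilde_norm_inner_K E0 F0 _ theta0 a0 b0 sf (lexx 0)).
  by rewrite (tilde_norm_inner_K E1 F1 _ theta1 a1 b1 sf (ltW u0)).
have r0 u : 0 < u -> 0 < rho_ u by exact: rho_gt0.
have Y0E f : sum_space X0 X1 f ->
    Y0 f = outer_norm E0 F0 a0 b0 theta0 (@posR R) (Kval X0 X1 f).
  by move=> sf; exact: XL_normE.
have Y1E f : sum_space X0 X1 f ->
    Y1 f = outer_norm E1 F1 a1 b1 theta1 (@posR R) (Kval X0 X1 f).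
  by move=> sf; exact: XL_normE.
have Y0_ge0 f : sum_space X0 X1 f -> (0 <= Y0 f)%E.
  by move=> sf; rewrite Y0E; [exact: tilde_norm_ge0|].
have Y1_ge0 f : sum_space X0 X1 f -> (0 <= Y1 f)%E.
  by move=> sf; rewrite Y1E; [exact: tilde_norm_ge0|].
have sumD f g : sum_space X0 X1 f -> sum_space X0 X1 g -> sum_space X0 X1 (f + g).
  exact: sum_spaceD.
have rhs_ge0 f u : sum_space X0 X1 f -> 0 < u -> (0 <= rhs f u)%E.
  move=> sf u0; rewrite (rhsE _ _ sf u0).
  have nf : (0 <= near f u)%E by exact: tilde_norm_ge0.
  have mf : (0 <= middle f u)%E.
    apply: mule_ge0; last exact: tilde_norm_ge0.
    by rewrite lee_fin ltW// (tail_norm_gt0 sb0 hbE0 u0).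
  have ff : (0 <= (rho_ u)%:E * far f u)%E.
    by apply: mule_ge0; [rewrite lee_fin ltW// r0|exact: tilde_norm_ge0].
  exact: (adde_ge0 (adde_ge0 nf mf) ff).
exists (D1 + D2); first exact: addr_gt0.
move=> f u [g0 [g1 [Yg0 Yg1 fE]]] u0.
have sf : sum_space X0 X1 f.
  rewrite fE; apply: sumD; [exact: XL_norm_sum_space Yg0|exact: XL_norm_sum_space Yg1].
have ru := r0 u u0.
have rhs0 := rhs_ge0 f u sf u0.
have qf := quasi_concave_K sf.
split.
- apply: (@le_trans _ _ (D1%:E * rhs f u)%E); last first.
    by apply: (lee_wpmul2r rhs0); rewrite lee_fin lerDl ltW.
  have [rhsy|rhsfin] := eqVneq (rhs f u) +oo%E.
    by rewrite rhsy gt0_muley ?lte_fin// leey.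
  have [f0 [f1 [m0 m1 f01 le2]]] := K_decomposition hV sf u0.
  have sf0 : sum_space X0 X1 f0.
    by exists f0, 0; split; [|exact: mem_space0|rewrite addr0].
  have sf1 : sum_space X0 X1 f1.
    by exists 0, f1; split; [exact: mem_space0| |rewrite add0r].
  have ku := qc_ge0 qf u0.
  have f0_le : fine (X0 f0) <= 2 * Kval X0 X1 f u.
    by apply: le_trans le2; rewrite lerDl mulr_ge0 ?(ltW u0)// fine_qb_norm_ge0.
  have f1_le : fine (X1 f1) <= 2 * (Kval X0 X1 f u / u).
    rewrite mulrA ler_pdivlMr// mulrC.
    by apply: le_trans le2; rewrite lerDr fine_qb_norm_ge0.
  have K0_le s : 0 < s -> Kval X0 X1 f0 s <= 2 * Kval X0 X1 f u.
    move=> s0; apply: le_trans f0_le.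
    have := K_le s0 m0 (mem_space0 X1) (esym (addr0 f0)).
    by rewrite qb_norm0/= mulr0 addr0.
  have K0N_le s : 0 < s -> Kval X0 X1 (- f0) s <= 2 * Kval X0 X1 f u.
    move=> s0; apply: le_trans f0_le.
    have := K_le s0 (mem_spaceN m0) (mem_space0 X1) (esym (addr0 (- f0))).
    by rewrite qb_norm0/= mulr0 addr0 qb_normN.
  have K1_le s : 0 < s -> Kval X0 X1 f1 s <= 2 * (Kval X0 X1 f u / u) * s.
    move=> s0; apply: le_trans (ler_wpM2r (ltW s0) f1_le).
    have := K_le s0 (mem_space0 X0) m1 (esym (add0r f1)).
    by rewrite qb_norm0/= add0r mulrC.
  have K1N_le s : 0 < s -> Kval X0 X1 (- f1) s <= 2 * (Kval X0 X1 f u / u) * s.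
    move=> s0; apply: le_trans (ler_wpM2r (ltW s0) f1_le).
    have := K_le s0 (mem_space0 X0) (mem_spaceN m1) (esym (add0r (- f1))).
    by rewrite qb_norm0/= add0r qb_normN mulrC.
  have sNf0 : sum_space X0 X1 (- f0).
    by exists (- f0), 0; split; [exact: mem_spaceN|exact: mem_space0|rewrite addr0].
  have sNf1 : sum_space X0 X1 (- f1).
    by exists 0, (- f1); split; [exact: mem_space0|exact: mem_spaceN|rewrite add0r].
  (* Before [u] the part [f1] is harmless and [f0] is compared with [f]; after
     [u] the roles are exchanged.  This gives the constant [3 * Ct]. *)
  have f0E : f0 = f + - f1 by rewrite f01 addrK.
  have f1E : f1 = f + - f0 by rewrite f01 addrC addKr.
  have two_three : 2 <= 3 * Ct by lra.
  have est := upper (Kval X0 X1 f) (Kval X0 X1 f0) (Kval X0 X1 f1) u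
    qf (quasi_concave_K sf0) (quasi_concave_K sf1) u0.
  have {}est : (Y0 f0 + (rho_ u)%:E * Y1 f1 <= D1%:E * rhs f u)%E.
    rewrite (Y0E _ sf0) (Y1E _ sf1) (rhsE _ _ sf u0); apply: est.
    - move=> s s0 su; rewrite [in X in X <= _]f0E.
      apply: (le_trans (hCt _ _ _ sf sNf1 s0)).
      rewrite (mulrC 3) -mulrA; apply: (ler_wpM2l (ltW Ct0)).
      have := K1N_le s s0; have := qc_div qf s0 su.
      rewrite mulrC -ler_pdivrMl// => h1 h2.
      have e1 : 2 * (Kval X0 X1 f u / u) * s = 2 * (u^-1 * (Kval X0 X1 f u * s)) by ring.
      rewrite e1 in h2; lra.
    - move=> s us; have s0 := lt_le_trans u0 us.
      apply: (le_trans (K0_le s s0)); exact: ler_wpM2r.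
    - move=> s s0 su; apply: (le_trans (K1_le s s0)).
      apply: (ler_wpM2r (ltW s0)); apply: ler_wpM2r => //.
      by rewrite divr_ge0// ltW.
    - move=> s us; have s0 := lt_le_trans u0 us.
      rewrite [in X in X <= _]f1E.
      apply: (le_trans (hCt _ _ _ sf sNf0 s0)).
      rewrite (mulrC 3) -mulrA; apply: (ler_wpM2l (ltW Ct0)).
      have := K0N_le s s0; have := qc_le qf u0 us; lra.
  have rhs_fin : (D1%:E * rhs f u < +oo)%E.
    rewrite lte_mul_pinfty ?lee_fin ?(ltW D10)// ltey//.
  have y00 := Y0_ge0 _ sf0; have y10 := Y1_ge0 _ sf1.
  have rY1 : (0 <= (rho_ u)%:E * Y1 f1)%E.
    by apply: mule_ge0 => //; rewrite lee_fin ltW.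
  have mY0 : mem_space Y0 f0.
    by apply: le_lt_trans rhs_fin; apply: le_trans est; exact: leeDl.
  have mY1 : mem_space Y1 f1.
    have : ((rho_ u)%:E * Y1 f1 < +oo)%E.
      by apply: le_lt_trans rhs_fin; apply: le_trans est; exact: leeDr.
    rewrite /mem_space/=; case: (Y1 f1) y10 => [y| |//] _; first by move=> _; exact: ltry.
    by rewrite gt0_muley// lte_fin.
  apply: le_trans est; apply: ereal_inf_lbound; exists f0, f1; split => //.
- apply: (@le_trans _ _ (D2%:E * Kfun Y0 Y1 (rho_ u) f)%E); last first.
    apply: lee_wpmul2r; last by rewrite lee_fin lerDr ltW.
    apply: le_ereal_inf_tmp => _ [f0 [f1 [m0 m1 _ ->]]].
    apply: adde_ge0; first exact: Y0_ge0 (XL_norm_sum_space m0).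
    by apply: mule_ge0; [rewrite lee_fin ltW|exact: Y1_ge0 (XL_norm_sum_space m1)].
  rewrite -lee_pdivrMl//.
  apply: le_ereal_inf_tmp => _ [f0 [f1 [m0 m1 f01 ->]]].
  rewrite lee_pdivrMl//.
  have sf0 := XL_norm_sum_space m0; have sf1 := XL_norm_sum_space m1.
  rewrite (Y0E _ sf0) (Y1E _ sf1) (rhsE _ _ sf u0).
  apply: (lower _ _ _ _ qf (quasi_concave_K sf0) (quasi_concave_K sf1) u0).
  by move=> s s0; rewrite f01; exact: hCt.
Qed.
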